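(* Let $q,s,t\in\mathbb{R}$ with $q=s$, $s>-1$, $s+t>-1$ and $s+2t>-1$. Then the operator $$P_{s,t}f(z)=(1-|z|^2)^t\int_{\mathbb{B}}K_{s+t}(z,w)f(w)(1-|w|^2)^{s}\,d\mu(w)$$ is bounded from $L^1_q$ to $L^{1,\infty}_q$, and it is not bounded from $L^1_q$ to $L^1_q$.
   Context: $N\ge 1$; $\langle z,w\rangle=\sum_{j=1}^N z_j\overline{w_j}$ and $|z|=\sqrt{\langle z,z\rangle}$ on $\mathbb{C}^N$; $\mathbb{B}=\{z\in\mathbb{C}^N:|z|<1\}$; $\mu$ is Lebesgue measure on $\mathbb{B}$ normalized so that $\mu(\mathbb{B})=1$; $d\mu_q(z)=(1-|z|^2)^q d\mu(z)$; $L^1_q=L^1(\mathbb{B},d\mu_q)$. Since $s+t>-1>-(N+1)$, the kernel is $K_{s+t}(z,w)=(1-\langle z,w\rangle)^{-(N+1+s+t)}$. Boundedness from $L^1_q$ to $L^{1,\infty}_q$ means: there is $C>0$ with $\mu_q(\{z\in\mathbb{B}:|P_{s,t}f(z)|>\lambda\})\le C\lambda^{-1}\|f\|_{L^1_q}$ for all $f\in L^1_q$ and $\lambda>0$. *)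

(* Defs.v *)
From HB Require Import structures.
From mathcomp Require Import all_boot all_order all_algebra.
From mathcomp Require Import complex.
From mathcomp Require Import all_classical all_reals all_analysis.
From mathcomp Require Import measurable_realfun.

Set Implicit Arguments.
Unset Strict Implicit.
Unset Printing Implicit Defensive.

Import Order.TTheory GRing.Theory Num.Theory.
Import numFieldNormedType.Exports.

Local Open Scope classical_set_scope.
Local Open Scope ring_scope.
Local Open Scope complex_scope.

Section complex_measurable.
Variable R : realType.

Definition complex_to_prod (z : R[i]) : measurableTypeR R * measurableTypeR R :=
  (complex.Re z, complex.Im z).

Definition prod_to_complex (p : measurableTypeR R * measurableTypeR R) : R[i] :=
  p.1 +i* p.2.

(* the Borel sigma-algebra of R[i], transported from R * R; C^n is n.-tuple R[i]
   with the product sigma-algebra *)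
HB.instance Definition _ := isPointed.Build R[i] 0.
HB.instance Definition _ :=
  Measurable.copy R[i] (g_sigma_algebra_preimageType complex_to_prod).

Lemma measurable_complex_to_prod : measurable_fun setT complex_to_prod.
Proof. by move=> _ B mB; exists B. Qed.

Lemma measurable_prod_to_complex : measurable_fun setT prod_to_complex.
Proof.
move=> _ _ [B mB <-]; rewrite !setTI -comp_preimage.
by rewrite (_ : _ \o _ = id)//; apply/funext => -[].
Qed.

End complex_measurable.


Section pushforward_sigma_finite.
Context d1 d2 (T1 : measurableType d1) (T2 : measurableType d2) (R : realType).
Variables (m : {measure set T1 -> \bar R}).
Variables (f : T1 -> T2) (g : T2 -> T1).
Hypotheses (mf : measurable_fun setT f) (mg : measurable_fun setT g).
Hypothesis fK : cancel f g.

Lemma pushforward_sigma_additive : semi_sigma_additive (pushforward m f).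
Proof. exact: measure_semi_sigma_additive. Qed.

Lemma pushforward_sigma_finite :
  sigma_finite setT m -> sigma_finite setT (pushforward m f).
Proof.
move=> [F TF Foo]; exists (fun n => g @^-1` F n) => [|n].
  by rewrite -preimage_bigcup -TF.
have [mF Fn] := Foo n; split.
  by rewrite -[X in measurable X]setTI; exact: mg.
by rewrite /pushforward -comp_preimage (_ : g \o f = id)//; apply/funext.
Qed.

End pushforward_sigma_finite.

(* needed explicitly: instance inference only finds sigma-finiteness of m1 \x m2
   when m1 and m2 are subprobabilities *)
Lemma product_sigma_finite d1 d2 (T1 : measurableType d1)
    (T2 : measurableType d2) (R : realType)
    (m1 : {sigma_finite_measure set T1 -> \bar R})
    (m2 : {sigma_finite_measure set T2 -> \bar R}) :
  sigma_finite setT (m1 \x m2)%E.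
Proof.
have /sigma_finiteP[F [TF ndF Foo]] := sigma_finiteT m1.
have /sigma_finiteP[G [TG ndG Goo]] := sigma_finiteT m2.
exists (fun n => F n `*` G n) => [|k].
  rewrite -setXTT TF TG; apply/seteqP; split=> -[x y] /=.
    move=> [[n _ Fnx] [k _ Gky]]; exists (maxn n k) => //; split.
    - by move: x Fnx; exact/subsetPset/ndF/leq_maxl.
    - by move: y Gky; exact/subsetPset/ndG/leq_maxr.
  by move=> [n _ []/= ? ?]; split; exists n.
have [? ?] := Foo k; have [? ?] := Goo k; split; first exact: measurableX.
by rewrite product_measure1E// lte_mul_pinfty// ge0_fin_numE.
Qed.

Section lebesgue_Cn.
Variable R : realType.

Definition lebesgue_R2 :
    {measure set (measurableTypeR R * measurableTypeR R)%type -> \bar R} :=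
  (@lebesgue_measure R \x @lebesgue_measure R)%E.

Definition lebesgue_C : set R[i] -> \bar R :=
  pushforward lebesgue_R2 (@prod_to_complex R).

Let lebesgue_C0 : lebesgue_C set0 = 0%E.
Proof. by rewrite /lebesgue_C /pushforward preimage_set0 measure0. Qed.

Let lebesgue_C_ge0 A : (0 <= lebesgue_C A)%E.
Proof. by rewrite /lebesgue_C /pushforward measure_ge0. Qed.

Let lebesgue_C_sigma_additive : semi_sigma_additive lebesgue_C.
Proof.
exact: (@pushforward_sigma_additive _ _ _ _ _ lebesgue_R2 _
  (@measurable_prod_to_complex R)).
Qed.

HB.instance Definition _ := isMeasure.Build _ _ _ lebesgue_C
  lebesgue_C0 lebesgue_C_ge0 lebesgue_C_sigma_additive.

Lemma complex_prodK : cancel (@prod_to_complex R) (@complex_to_prod R).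
Proof. by case. Qed.

Let lebesgue_C_sigma_finite : sigma_finite setT lebesgue_C.
Proof.
exact: (@pushforward_sigma_finite _ _ _ _ _ lebesgue_R2 _ _
  (@measurable_complex_to_prod R) complex_prodK (product_sigma_finite _ _)).
Qed.

HB.instance Definition _ := Measure_isSigmaFinite.Build _ _ _ lebesgue_C
  lebesgue_C_sigma_finite.

Definition tuple_cons n (p : R[i] * n.-tuple R[i]) : n.+1.-tuple R[i] :=
  [tuple of p.1 :: p.2].

Definition tuple_uncons n (v : n.+1.-tuple R[i]) : R[i] * n.-tuple R[i] :=
  (thead v, [tuple of behead v]).

Lemma tuple_consK n : cancel (@tuple_cons n) (@tuple_uncons n).
Proof. by case=> a v; congr pair; exact/val_inj. Qed.

Lemma measurable_tuple_cons n : measurable_fun setT (@tuple_cons n).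
Proof. exact: measurable_cons. Qed.

Lemma measurable_tuple_uncons n : measurable_fun setT (@tuple_uncons n).
Proof.
apply/measurable_fun_pairP; split; first exact: measurable_tnth.
exact: measurable_behead.
Qed.

Section step.
Variables (n : nat) (m : {sigma_finite_measure set (n.-tuple R[i]) -> \bar R}).

Let lebesgue_prod :
    {measure set (R[i] * n.-tuple R[i])%type -> \bar R} :=
  (lebesgue_C \x m)%E.

Definition lebesgue_step : set (n.+1.-tuple R[i]) -> \bar R :=
  pushforward lebesgue_prod (@tuple_cons n).

Let lebesgue_step0 : lebesgue_step set0 = 0%E.
Proof. by rewrite /lebesgue_step /pushforward preimage_set0 measure0. Qed.

Let lebesgue_step_ge0 A : (0 <= lebesgue_step A)%E.
Proof. by rewrite /lebesgue_step /pushforward measure_ge0. Qed.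

Let lebesgue_step_sigma_additive : semi_sigma_additive lebesgue_step.
Proof.
exact: (@pushforward_sigma_additive _ _ _ _ _ lebesgue_prod _
  (@measurable_tuple_cons n)).
Qed.

HB.instance Definition _ := isMeasure.Build _ _ _ lebesgue_step
  lebesgue_step0 lebesgue_step_ge0 lebesgue_step_sigma_additive.

Let lebesgue_step_sigma_finite : sigma_finite setT lebesgue_step.
Proof.
exact: (@pushforward_sigma_finite _ _ _ _ _ lebesgue_prod _ _
  (@measurable_tuple_uncons n) (@tuple_consK n) (product_sigma_finite _ _)).
Qed.

HB.instance Definition _ := Measure_isSigmaFinite.Build _ _ _ lebesgue_step
  lebesgue_step_sigma_finite.

End step.

(* Lebesgue measure on C^n = R^(2n), as an iterated product measure *)
Fixpoint lebesgue_Cn (n : nat) :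
    {sigma_finite_measure set (n.-tuple R[i]) -> \bar R} :=
  if n is n'.+1 then lebesgue_step (lebesgue_Cn n') else \d_[tuple].

End lebesgue_Cn.

Notation normc := ComplexField.Normc.normc.

Section complex_power.
Variable R : realType.
Implicit Types (z : R[i]) (a : R).

Definition cexp z : R[i] :=
  (expR (complex.Re z) * cos (complex.Im z)) +i*
  (expR (complex.Re z) * sin (complex.Im z)).

(* principal argument, with values in ]-pi, pi] when z != 0 *)
Definition carg z : R :=
  if 0 <= complex.Im z then acos (complex.Re z / normc z)
  else - acos (complex.Re z / normc z).

Definition clog z : R[i] := ln (normc z) +i* carg z.

Definition cpow z a : R[i] := cexp (a%:C * clog z).

End complex_power.

Section unit_ball.
Variables (R : realType) (N : nat).
Local Notation CN := (N.-tuple R[i]).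
Implicit Types z w : CN.

Definition cdot z w : R[i] := \sum_(j < N) tnth z j * conjc (tnth w j).

Definition cnorm z : R := Num.sqrt (complex.Re (cdot z z)).

Definition cball : set CN := [set z | cnorm z < 1].

Lemma cdotzzE z : complex.Re (cdot z z) =
  \sum_(j < N) (complex.Re (tnth z j) ^+ 2 + complex.Im (tnth z j) ^+ 2).
Proof.
rewrite /cdot (big_morph _ (_ : {morph @complex.Re R : x y / x + y})
  (_ : _ = 0))//; last first.
  by case=> ? ? [].
by apply: eq_bigr => j _; case: (tnth z j) => a b /=; rewrite mulrN opprK.
Qed.

Lemma cdotzz_ge0 z : 0 <= complex.Re (cdot z z).
Proof. by rewrite cdotzzE sumr_ge0// => j _; rewrite addr_ge0 ?sqr_ge0. Qed.

Lemma cballE : cball = [set z | complex.Re (cdot z z) < 1].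
Proof.
apply/seteqP; split => z; rewrite /cball /cnorm /= => h.
  rewrite -[X in _ < X](expr1n _ 2) -(sqr_sqrtr (cdotzz_ge0 z)).
  by rewrite ltr_pXn2r ?nnegrE ?sqrtr_ge0.
by rewrite -sqrtr1 ltr_sqrt.
Qed.

Lemma measurable_cdotzz :
  measurable_fun [set: CN] (fun z => complex.Re (cdot z z)).
Proof.
under eq_fun do rewrite cdotzzE.
apply: measurable_sum => j.
have m1 := measurableT_comp (@measurable_complex_to_prod R)
  (@measurable_tnth _ _ N j).
apply: measurable_funD; apply: measurable_funX.
  exact: (measurableT_comp measurable_fst m1).
exact: (measurableT_comp measurable_snd m1).
Qed.

Lemma measurable_cball : measurable cball.
Proof.
rewrite cballE -[X in measurable X]setTI.
have -> : [set z | complex.Re (cdot z z) < 1] =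
    (fun z => complex.Re (cdot z z)) @^-1` `]-oo, 1[%classic.
  by apply/seteqP; split=> z /=; rewrite in_itv.
by apply: measurable_cdotzz => //; exact: measurable_itv.
Qed.

End unit_ball.

Section box.
Variable R : realType.

Definition csquare (e : R) : set R[i] :=
  @complex_to_prod R @^-1` (`[- e, e]%classic `*` `[- e, e]%classic).

Lemma measurable_csquare (e : R) : measurable (csquare e).
Proof.
rewrite -[X in measurable X]setTI; apply: measurable_complex_to_prod => //.
by apply: measurableX; exact: measurable_itv.
Qed.

Lemma lebesgue_csquare (e : R) : 0 < e -> lebesgue_C (csquare e) = ((2 * e) ^+ 2)%:E.
Proof.
move=> e0; rewrite /lebesgue_C /pushforward /csquare -comp_preimage.
rewrite (_ : _ \o _ = id); last by apply/funext => -[].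
rewrite preimage_id /lebesgue_R2 /= product_measure1E//=; do ?exact: measurable_itv.
rewrite lebesgue_measure_itv/= lte_fin gtrN// -EFinB -EFinM; congr EFin.
by rewrite opprK -mulr2n expr2 !mulr_natl.
Qed.

Definition cbox n (e : R) : set (n.-tuple R[i]) :=
  [set v | forall j, csquare e (tnth v j)].

Lemma measurable_cbox n (e : R) : measurable (@cbox n e).
Proof.
rewrite (_ : @cbox n e =
    \bigcap_(j in [set: 'I_n]) ((@tnth n R[i] ^~ j) @^-1` csquare e)).
  apply: fin_bigcap_measurable => // j _; rewrite -[X in measurable X]setTI.
  by apply: measurable_tnth => //; exact: measurable_csquare.
by apply/seteqP; split=> v /= h j; [move=> _|]; exact: h.
Qed.

Lemma lebesgue_cbox n (e : R) : 0 < e ->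
  lebesgue_Cn R n (@cbox n e) = ((2 * e) ^+ 2 ^+ n)%:E.
Proof.
move=> e0; elim: n => [|n ih].
  by rewrite /= diracE expr0 mem_set// => -[].
rewrite /= /lebesgue_step /pushforward.
rewrite (_ : _ @^-1` _ = csquare e `*` @cbox n e); last first.
  apply/seteqP; split=> -[a v] /=.
    move=> h; split; first exact: (h ord0).
    by move=> j; have := h (lift ord0 j); rewrite tnthS.
  move=> [ha hv] j; case: (unliftP ord0 j) => [i ->|->]//.
  by rewrite tnthS; exact: hv.
transitivity ((@lebesgue_C R \x lebesgue_Cn R n)%E (csquare e `*` @cbox n e)); first by [].
rewrite product_measure1E//=; [|exact: measurable_csquare|exact: measurable_cbox].
by rewrite [X in (_ * X)%E]ih lebesgue_csquare// -EFinM [in RHS]exprS.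
Qed.

End box.
Section normalized.
Variables (R : realType) (N : nat).
Local Notation CN := (N.-tuple R[i]).

Lemma cball_sub_cbox : @cball R N `<=` @cbox R N 1.
Proof.
rewrite cballE => z /=; rewrite cdotzzE => zlt1 j.
have : complex.Re (tnth z j) ^+ 2 + complex.Im (tnth z j) ^+ 2 <= 1.
  apply: le_trans (ltW zlt1); rewrite (bigD1 j)//= lerDl.
  by rewrite sumr_ge0// => k _; rewrite addr_ge0 ?sqr_ge0.
rewrite /csquare /= !in_itv /= -!ler_norml => h.
by split; rewrite -[_ <= 1](@ler_pXn2r _ 2%N)// ?nnegrE// expr1n real_normK ?num_real//;
  apply: le_trans h; rewrite ?lerDl ?lerDr sqr_ge0.
Qed.

Lemma cbox_sub_cball : @cbox R N (2 * N.+1%:R)^-1 `<=` @cball R N.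
Proof.
rewrite cballE => z /= h; rewrite cdotzzE.
set e : R := (2 * N.+1%:R)^-1 in h.
have e0 : 0 < e by rewrite invr_gt0.
apply: (@le_lt_trans _ _ (\sum_(j < N) e)).
  apply: ler_sum => j _; have := h j; rewrite /csquare /= !in_itv /= -!ler_norml.
  move=> [h1 h2].
  have sqr_le (x : R) : `|x| <= e -> x ^+ 2 <= e / 2.
    move=> xe; rewrite -real_normK ?num_real//.
    apply: (@le_trans _ _ (e ^+ 2)); first by rewrite ler_pXn2r ?nnegrE// ltW.
    rewrite expr2 ler_pM2l// /e invfM ler_piMr// invf_le1//.
    by rewrite ler1n.
  by rewrite [leRHS]splitr lerD// sqr_le.
rewrite sumr_const card_ord -mulr_natl /e ltr_pdivrMr// mul1r.
rewrite (@lt_le_trans _ _ N.+1%:R) ?ltr_nat//.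
by rewrite ler_peMl// ler1n.
Qed.

Lemma lebesgue_cball_gt0 : (0 < lebesgue_Cn R N (@cball R N))%E.
Proof.
have [mb mB] := (@measurable_cbox R N (2 * N.+1%:R)^-1, @measurable_cball R N).
have : (lebesgue_Cn R N (@cbox R N (2 * N.+1%:R)^-1) <=
        lebesgue_Cn R N (@cball R N))%E.
  by apply: le_measure; rewrite ?inE//; exact: cbox_sub_cball.
apply: lt_le_trans.
by rewrite lebesgue_cbox ?invr_gt0// lte_fin !exprn_gt0// mulr_gt0// invr_gt0.
Qed.

Lemma lebesgue_cball_lty : (lebesgue_Cn R N (@cball R N) < +oo)%E.
Proof.
have [mb mB] := (@measurable_cbox R N 1, @measurable_cball R N).
have : (lebesgue_Cn R N (@cball R N) <= lebesgue_Cn R N (@cbox R N 1))%E.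
  by apply: le_measure; rewrite ?inE//; exact: cball_sub_cbox.
by move/le_lt_trans; apply; rewrite lebesgue_cbox// ltry.
Qed.

Let inv_vol_ge0 : 0 <= (fine (lebesgue_Cn R N (@cball R N)))^-1.
Proof. by rewrite invr_ge0 fine_ge0. Qed.

(* a measure on the whole of C^N: every use below restricts it to the ball *)
Definition ball_measure : {measure set CN -> \bar R} :=
  mscale (NngNum inv_vol_ge0) (lebesgue_Cn R N).

Lemma ball_measure1 : ball_measure (@cball R N) = 1%E.
Proof.
have f : lebesgue_Cn R N (@cball R N) \is a fin_num.
  by rewrite ge0_fin_numE ?measure_ge0 ?lebesgue_cball_lty.
rewrite /ball_measure /= /mscale /= -{2}(fineK f) -EFinM mulVf// gt_eqF//.
by rewrite -lte_fin fineK// lebesgue_cball_gt0.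
Qed.

End normalized.

Section operators.
Variables (R : realType) (N : nat).
Local Notation CN := (N.-tuple R[i]).
Local Notation B := (@cball R N).
Local Notation mu := (ball_measure R N).
Implicit Types (f : CN -> R[i]) (q s t : R).

Definition ball_weight q (z : CN) : R := (1 - cnorm z ^+ 2) `^ q.

Definition mu_ q (A : set CN) : \bar R :=
  (\int[mu]_(z in A `&` B) (ball_weight q z)%:E)%E.

(* the integral of |f| against d(mu_ q) = (1 - |z|^2)^q d(mu) *)
Definition L1norm q f : \bar R :=
  (\int[mu]_(z in B) (normc (f z) * ball_weight q z)%:E)%E.

Definition L1 q : set (CN -> R[i]) :=
  [set f | measurable_fun B f /\ (L1norm q f < +oo)%E].

Definition cintegral f : R[i] :=
  (\int[mu]_(w in B) complex.Re (f w)) +i*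
  (\int[mu]_(w in B) complex.Im (f w)).

(* for z, w in the ball, 1 - <z, w> has positive real part and the power is
   the principal one; this is the kernel of index a only when - (N + 1) < a *)
Definition bergman_kernel (a : R) (z w : CN) : R[i] :=
  cpow (1 - cdot z w) (- (N%:R + 1 + a)).

Definition bergman_op s t f (z : CN) : R[i] :=
  (ball_weight t z)%:C *
  cintegral (fun w => bergman_kernel (s + t) z w * f w * (ball_weight s w)%:C).

(* the measurability of T f makes the distribution function meaningful *)
Definition bounded_L1_weakL1 q (T : (CN -> R[i]) -> CN -> R[i]) : Prop :=
  exists2 C : R, 0 < C & forall f, L1 q f ->
    measurable_fun B (T f) /\
    forall lambda : R, 0 < lambda ->
      (mu_ q [set z | B z /\ (lambda < normc (T f z))%R] <=
       (C / lambda)%:E * L1norm q f)%E.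

Definition bounded_L1_L1 q (T : (CN -> R[i]) -> CN -> R[i]) : Prop :=
  exists2 C : R, 0 < C & forall f, L1 q f ->
    L1 q (T f) /\ (L1norm q (T f) <= C%:E * L1norm q f)%E.

End operators.

(* Main.v *)
(** Write rho(z, w) = |1 - <z, w>|, a quasi-metric on the ball, delta(z) = 1 - |z|^2 and
    d = N + 1 + s.  The region {w | rho(z, w) < r, delta(w) < h} has mu_s-measure at most
    C r^N h^(1+s).

    Weak type: only the modulus delta(z)^t rho(z, w)^(-(d+t)) of the kernel matters.  Decomposing
    it over the scales r = 2^l delta(z), l >= 0, one sees that |P f(z)| > lambda forces, for some l,
    F {w | rho(z, w) < r} > c lambda 2^(-l a) r^d, where F = |f| mu_s, a = eps - t and
    eps = (1 + s + t) / 2.  For fixed l, a greedy Vitali selection among the corresponding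
    quasi-balls covers all such z by finitely many regions with radius comparable to r_i and
    height comparable to 2^(-l) r_i; their measures add up to at most
    C 2^(-l (1+s)) 2^(l a) ||f|| / lambda, which is summable in l because 1 + s - a = eps > 0.
    This needs neither cancellation nor an L^2 bound.

    Unboundedness: let D_k be the box of points with z_1 within c 4^-k of 1 - 4^-k and the
    other coordinates of size at most c 2^-k, and take f = 1_{D_m}.  For z in D_k with k <= m and
    w in D_m, the argument of 1 - <z, w> is so small that Re K(z, w) is comparable to |K(z, w)|, and
    each of the disjoint boxes D_1, ..., D_m contributes at least c' ||f|| to ||P f||. *)

Require Import Defs.
From HB Require Import structures.
From mathcomp Require Import all_boot all_order all_algebra.
From mathcomp Require Import complex ring lra.
From mathcomp Require Import all_classical all_reals all_analysis.
From mathcomp Require Import measurable_realfun.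

Set Implicit Arguments.
Unset Strict Implicit.
Unset Printing Implicit Defensive.

Import Order.TTheory GRing.Theory Num.Theory.
Import numFieldNormedType.Exports.

Local Open Scope classical_set_scope.
Local Open Scope ring_scope.
Local Open Scope complex_scope.

(** * Geometry of the ball *)

(** The surplus 1 + s + t > 0 has to pay for two geometric series. Summing the kernel over the
    scales leaves 2^(-l (a + t)), and summing the measures of the covers leaves 2^(-l (1 + s - a));
    the choice a = eps - t, with [eps] half of the surplus, makes both equal to 2^(-l eps). The
    factor 2^(-l (1 + s)) is what an ordinary maximal function argument would discard: a point that
    is bad at scale l lies at height 2^(-l) r, so only a thin shell of the enlarged quasi-ball has
    to be covered. The covering is carried out on {delta >= e} for fixed e > 0. There every selected
    quasi-ball carries a definite amount of mass, so the greedy choice stops, and only finitely many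
    scales occur. The bounds do not depend on e, which tends to 0 at the very end. The volume of a
    shell is estimated without rotating its centre onto an axis: some real coordinate is bounded
    away from 0, and Fubini is applied with that coordinate innermost. *)

Section modulus.
Variable R : rcfType.
Implicit Types x y : R[i].

Lemma normc_sqr x : normc x ^+ 2 = complex.Re x ^+ 2 + complex.Im x ^+ 2.
Proof. by case: x => a b /=; rewrite sqr_sqrtr// addr_ge0 ?sqr_ge0. Qed.

Lemma normc_ge0 x : 0 <= normc x.
Proof. by case: x => a b; exact: sqrtr_ge0. Qed.

Lemma normr_Re_le x : `|complex.Re x| <= normc x.
Proof.
rewrite -(@ler_pXn2r _ 2)// ?nnegrE ?normc_ge0// normc_sqr real_normK ?num_real//.
by rewrite lerDl sqr_ge0.
Qed.

Lemma normr_Im_le x : `|complex.Im x| <= normc x.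
Proof.
rewrite -(@ler_pXn2r _ 2)// ?nnegrE ?normc_ge0// normc_sqr real_normK ?num_real//.
by rewrite lerDr sqr_ge0.
Qed.

Lemma normc_le_ReIm x : normc x <= `|complex.Re x| + `|complex.Im x|.
Proof.
rewrite -(@ler_pXn2r _ 2)// ?nnegrE ?normc_ge0 ?addr_ge0// normc_sqr.
rewrite sqrrD !real_normK ?num_real// addrAC lerDl mulrn_wge0//.
Qed.

Lemma normcD_le x y : normc (x + y) <= normc x + normc y.
Proof. by rewrite -lecR; have := ler_normD x y; rewrite !complex.normc_def
  -!rmorphD /=; case: x y => [a b] [c d]. Qed.

Lemma normcJ_eq x : normc (conjc x) = normc x.
Proof. by case: x => a b /=; rewrite sqrrN. Qed.

Lemma normcN_eq x : normc (- x) = normc x.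
Proof. by case: x => a b /=; rewrite !sqrrN. Qed.

Lemma normcB_le x y : normc (x - y) <= normc x + normc y.
Proof. by rewrite (le_trans (normcD_le _ _))// normcN_eq. Qed.

Lemma normc_real (a : R) : normc a%:C = `|a|.
Proof. by rewrite /= expr0n addr0 sqrtr_sqr. Qed.

Lemma cReD x y : complex.Re (x + y) = complex.Re x + complex.Re y.
Proof. by case: x y => ? ? []. Qed.

Lemma cImD x y : complex.Im (x + y) = complex.Im x + complex.Im y.
Proof. by case: x y => ? ? []. Qed.

Lemma cReN x : complex.Re (- x) = - complex.Re x.
Proof. by case: x. Qed.

Lemma cImN x : complex.Im (- x) = - complex.Im x.
Proof. by case: x. Qed.

Lemma cReM x y : complex.Re (x * y) =
  complex.Re x * complex.Re y - complex.Im x * complex.Im y.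
Proof. by case: x y => ? ? []. Qed.

Lemma cImM x y : complex.Im (x * y) =
  complex.Re x * complex.Im y + complex.Im x * complex.Re y.
Proof. by case: x y => ? ? []. Qed.

Lemma cReJ x : complex.Re (conjc x) = complex.Re x.
Proof. by case: x. Qed.

Lemma cImJ x : complex.Im (conjc x) = - complex.Im x.
Proof. by case: x. Qed.

Lemma cRe_sum (I : Type) (r : seq I) (P : pred I) (F : I -> R[i]) :
  complex.Re (\sum_(i <- r | P i) F i) = \sum_(i <- r | P i) complex.Re (F i).
Proof. exact: (big_morph _ cReD). Qed.

Lemma cIm_sum (I : Type) (r : seq I) (P : pred I) (F : I -> R[i]) :
  complex.Im (\sum_(i <- r | P i) F i) = \sum_(i <- r | P i) complex.Im (F i).
Proof. exact: (big_morph _ cImD). Qed.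

Lemma normc_sum_le (I : Type) (r : seq I) (P : pred I) (F : I -> R[i]) :
  normc (\sum_(i <- r | P i) F i) <= \sum_(i <- r | P i) normc (F i).
Proof.
elim/big_ind2 : _ => [|x a y b xa yb|//]; first by rewrite ComplexField.Normc.normc0.
by rewrite (le_trans (normcD_le _ _))// lerD.
Qed.

Lemma normcMJ_le x y : normc (x * conjc y) <= (normc x ^+ 2 + normc y ^+ 2) / 2.
Proof.
rewrite ComplexField.Normc.normcM normcJ_eq.
have := sqr_ge0 (normc x - normc y); nra.
Qed.

End modulus.

Section ball_geometry.
Variables (R : realType) (N : nat).
Local Notation CN := (N.-tuple R[i]).
Local Notation B := (@cball R N).
Implicit Types z w v : CN.

Definition rho z w : R := normc (1 - cdot z w).

Definition delta z : R := 1 - cnorm z ^+ 2.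

Definition sqdist z w : R := \sum_(j < N) normc (tnth z j - tnth w j) ^+ 2.

Lemma rho_ge0 z w : 0 <= rho z w.
Proof. exact: normc_ge0. Qed.

Lemma cnorm_sqr z : cnorm z ^+ 2 = complex.Re (cdot z z).
Proof. by rewrite /cnorm sqr_sqrtr// cdotzz_ge0. Qed.

Lemma cnorm_sqrE z : cnorm z ^+ 2 = \sum_(j < N) normc (tnth z j) ^+ 2.
Proof. by rewrite cnorm_sqr cdotzzE; apply: eq_bigr => j _; rewrite normc_sqr. Qed.

Lemma deltaE z : delta z = 1 - \sum_(j < N) normc (tnth z j) ^+ 2.
Proof. by rewrite /delta cnorm_sqrE. Qed.

Lemma delta_gt0 z : B z <-> 0 < delta z.
Proof. by rewrite cballE /= /delta subr_gt0 cnorm_sqr. Qed.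

Lemma delta_le1 z : delta z <= 1.
Proof. by rewrite /delta lerBlDr lerDl sqr_ge0. Qed.

Lemma cdotzz_real z : cdot z z = (cnorm z ^+ 2)%:C.
Proof.
rewrite cnorm_sqrE /cdot (big_morph (real_complex R) (rmorphD _) (rmorph0 _)).
apply: eq_bigr => j _; rewrite normc_sqr; case: (tnth z j) => a b.
by apply/eqP; rewrite eq_complex /=; apply/andP; split; apply/eqP; ring.
Qed.

Lemma cdotC z w : cdot w z = conjc (cdot z w).
Proof.
rewrite /cdot rmorph_sum; apply: eq_bigr => j _.
by rewrite rmorphM /= conjcK mulrC.
Qed.

Lemma rhoC z w : rho z w = rho w z.
Proof.
rewrite /rho -[LHS]normcJ_eq [cdot w z]cdotC; congr normc.
by case: (cdot z w) => a b; apply/eqP; rewrite eq_complex /= eqxx !sub0r eqxx.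
Qed.

Lemma sqdistE z w :
  sqdist z w = cnorm z ^+ 2 + cnorm w ^+ 2 - 2 * complex.Re (cdot z w).
Proof.
rewrite /sqdist !cnorm_sqrE /cdot cRe_sum mulr_sumr -big_split -sumrB /=.
apply: eq_bigr => j _; rewrite !normc_sqr.
case: (tnth z j) (tnth w j) => [a b] [c d] /=; ring.
Qed.

Lemma Re_rho_le z w : complex.Re (1 - cdot z w) <= rho z w.
Proof. exact: le_trans (ler_norm _) (normr_Re_le _). Qed.

(** Both squared norms are below 1, so |z - w|^2 <= 2 Re (1 - <z, w>): a quasi-ball of radius r has
    Euclidean radius O(sqrt r). *)
Lemma sqdist_le_rho z w : B z -> B w -> sqdist z w <= 2 * rho z w.
Proof.
move=> /delta_gt0 + /delta_gt0; rewrite /delta => z1 w1.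
have := Re_rho_le z w; rewrite sqdistE cReD cReN /= ; lra.
Qed.

Lemma cdot_le z w : normc (cdot z w) <= (cnorm z ^+ 2 + cnorm w ^+ 2) / 2.
Proof.
rewrite !cnorm_sqrE -big_split /= mulr_suml.
by rewrite (le_trans (normc_sum_le _ _ _))// ler_sum// => j _; exact: normcMJ_le.
Qed.

(** Here 1 - |<z, w>| is at least 1 - (|z|^2 + |w|^2) / 2, which exceeds half of [delta z] because
    |w| < 1. Hence a dyadic decomposition around z may start at the radius [delta z]. *)
Lemma delta_le_rho z w : B w -> delta z <= 2 * rho z w.
Proof.
move=> /delta_gt0; rewrite /delta => w1; have := cdot_le z w.
have := normcD_le (1 - cdot z w) (cdot z w); rewrite subrK.
rewrite ComplexField.Normc.normc1 -/(rho z w); lra.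
Qed.

Lemma rho_lt2 z w : B z -> B w -> rho z w < 2.
Proof.
move=> /delta_gt0 + /delta_gt0; rewrite /delta => z1 w1; have := cdot_le z w.
have := normcB_le 1 (cdot z w); rewrite ComplexField.Normc.normc1 -/(rho z w); lra.
Qed.

Lemma rho_gt0 z w : B z -> B w -> 0 < rho z w.
Proof. by move=> /delta_gt0 z0 /(delta_le_rho z); lra. Qed.

(* <z - w, w - v> = <z, w> - <z, v> - <w, w> + <w, v> is bounded by AM-GM,
   so that Cauchy-Schwarz is not needed *)
Lemma rho_quasi_triangle w z v : B z -> B w -> B v ->
  rho z v <= 4 * (rho z w + rho w v).
Proof.
move=> Bz Bw Bv.
set p := \sum_(j < N) (tnth z j - tnth w j) * conjc (tnth w j - tnth v j).
have pE : p = cdot z w - cdot z v - cdot w w + cdot w v.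
  rewrite /p /cdot -!sumrB -big_split /=; apply: eq_bigr => j _.
  by rewrite rmorphB /=; ring.
have -> : rho z v = normc (1 - cdot z w + p + (1 - cdot w v) - (delta w)%:C).
  rewrite /rho (_ : (delta w)%:C = 1 - cdot w w).
    by rewrite pE; congr normc; ring.
  by rewrite cdotzz_real /delta rmorphB rmorph1.
have := normcB_le (1 - cdot z w + p + (1 - cdot w v)) (delta w)%:C.
have := normcD_le (1 - cdot z w + p) (1 - cdot w v).
have := normcD_le (1 - cdot z w) p.
have : normc p <= (sqdist z w + sqdist w v) / 2.
  rewrite /sqdist -big_split /= mulr_suml.
  by rewrite (le_trans (normc_sum_le _ _ _))// ler_sum// => j _; exact: normcMJ_le.
have := sqdist_le_rho Bz Bw; have := sqdist_le_rho Bw Bv.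
have := delta_le_rho w Bv; have /delta_gt0 w0 := Bw.
rewrite normc_real gtr0_norm// -/(rho z w) -/(rho w v).
have := rho_ge0 z w; lra.
Qed.

End ball_geometry.

(** * Volume of the regions rho < r, delta < h *)

Section product_slices.
Local Open Scope ereal_scope.
Context d1 d2 (T1 : measurableType d1) (T2 : measurableType d2) (R : realType).

Lemma indic_scale_integral d (T : measurableType d) (m : {measure set T -> \bar R})
    (A : set T) (c : R) : measurable A -> (0 <= c)%R ->
  c%:E * m A = \int[m]_x (c%:E * (\1_A x)%:E).
Proof.
move=> mA c0; rewrite ge0_integralZl//.
- by rewrite integral_indic// setIT.
- exact/measurable_EFinP.
Qed.

Variables (m1 : {sigma_finite_measure set T1 -> \bar R})
  (m2 : {sigma_finite_measure set T2 -> \bar R}).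

Lemma product_measure_le_xsection (S : set (T1 * T2)) (A : set T1) (c : R) :
  measurable S -> measurable A -> (0 <= c)%R ->
  (forall x y, S (x, y) -> A x) ->
  (forall x, A x -> m2 (xsection S x) <= c%:E) ->
  (m1 \x m2) S <= c%:E * m1 A.
Proof.
move=> mS mA c0 SA Sc.
rewrite indic_scale_integral//.
rewrite /product_measure1; apply: ge0_le_integral => //=.
- exact: measurable_fun_xsection.
- by apply/measurable_EFinP; exact: measurable_funM.
move=> x _; have [Ax|nAx] := pselect (A x).
  by rewrite indicE mem_set// mule1; exact: Sc.
rewrite indicE memNset// mule0.
rewrite (_ : xsection S x = set0) ?measure0//.
by apply/seteqP; split => // y /=; rewrite /xsection /= inE => /SA.
Qed.

Lemma product_measure_ysectionE (S : set (T1 * T2)) : measurable S ->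
  (m1 \x m2) S = \int[m2]_y m1 (ysection S y).
Proof.
move=> mS; have := indic_fubini_tonelli m1 m2 mS.
by rewrite indic_fubini_tonelli_FE// indic_fubini_tonelli_GE.
Qed.

Lemma product_measure_le_ysection (S : set (T1 * T2)) (A : set T2) (c : R) :
  measurable S -> measurable A -> (0 <= c)%R ->
  (forall x y, S (x, y) -> A y) ->
  (forall y, A y -> m1 (ysection S y) <= c%:E) ->
  (m1 \x m2) S <= c%:E * m2 A.
Proof.
move=> mS mA c0 SA Sc; rewrite product_measure_ysectionE//.
rewrite indic_scale_integral//.
apply: ge0_le_integral => //=.
- exact: measurable_fun_ysection.
- by apply/measurable_EFinP; exact: measurable_funM.
move=> y _; have [Ay|nAy] := pselect (A y).
  by rewrite indicE mem_set// mule1; exact: Sc.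
rewrite indicE memNset// mule0.
rewrite (_ : ysection S y = set0) ?measure0//.
by apply/seteqP; split => // x /=; rewrite /ysection /= inE => /SA.
Qed.

End product_slices.

Section finite_union.
Context d (T : measurableType d) (R : realType).
Variable m : {measure set T -> \bar R}.

Lemma measure_le_sum_cover (I : choiceType) (r : seq I) (F : I -> set T) (S : set T) :
  measurable S -> (forall i, measurable (F i)) ->
  (forall x, S x -> exists2 i, i \in r & F i x) ->
  (m S <= \sum_(i <- r) m (F i))%E.
Proof.
move=> mS mF; elim: r S mS => [S mS Sr|i r IH S mS Sr].
  rewrite big_nil (_ : S = set0) ?measure0//.
  by apply/seteqP; split=> // x /Sr[].
rewrite big_cons (le_trans (_ : _ <= m ((S `&` F i) `|` (S `\` F i)))%E)//.
  by rewrite setUIDK.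
rewrite (le_trans (measureU2 _ _ _))//; [exact: measurableI|exact: measurableD|].
apply: leeD; first by apply: le_measure; rewrite ?inE//; exact: measurableI.
apply: IH; first exact: measurableD.
by move=> x [/Sr[j]]; rewrite inE => /orP[/eqP->//|jr Fj] _; exists j.
Qed.

End finite_union.

Section plane_measure.
Variable R : realType.
Local Notation leb := (@lebesgue_measure R).

Lemma lebesgue_itv_radius (x b : R) : 0 <= b ->
  leb `[x - b, x + b]%classic = (2 * b)%:E.
Proof.
move=> b0; rewrite lebesgue_measure_itv/= lte_fin; case: ifPn => h.
  by rewrite -EFinD; congr EFin; ring.
by congr EFin; move: h; rewrite -leNgt; lra.
Qed.

(** The interval of radius [b] about any point of [S] contains [S], whence the factor 2. *)
Lemma lebesgue_le_diam (S : set (measurableTypeR R)) (b : R) : measurable S -> 0 <= b ->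
  (forall x y, S x -> S y -> `|x - y| <= b) -> (leb S <= (2 * b)%:E)%E.
Proof.
move=> mS b0 Sb; have [[x Sx]|/forallNP S0] := pselect (exists x, S x); last first.
  rewrite (_ : S = set0) ?measure0 ?lee_fin ?mulr_ge0//.
  by apply/seteqP; split=> // y /S0.
have : (leb S <= leb `[(x - b)%R, (x + b)%R])%E.
  apply: le_measure; rewrite ?inE//.
  by move=> y Sy /=; rewrite in_itv /=; have := Sb _ _ Sx Sy; rewrite ler_distlC.
by rewrite lebesgue_itv_radius.
Qed.

Lemma lebesgue_CE (S : set R[i]) :
  lebesgue_C S = (leb \x leb)%E (@prod_to_complex R @^-1` S).
Proof. by []. Qed.

(** Cavalieri along horizontal lines, 2 b times 2 m. The real parts are compared only between points
    with the same imaginary part, which is all that a bound on the variation of |x|^2 can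
    provide. *)
Lemma lebesgue_C_le_Re (S : set R[i]) (b m : R) : measurable S -> 0 <= b -> 0 <= m ->
  (forall x y, S x -> S y -> `|complex.Im x - complex.Im y| <= b) ->
  (forall x y, S x -> S y -> complex.Im x = complex.Im y ->
     `|complex.Re x - complex.Re y| <= m) ->
  (lebesgue_C S <= (4 * b * m)%:E)%E.
Proof.
move=> mS b0 m0 Sb Sm.
have [[[x1 x2] Sx]|/forallNP S0] := pselect (exists x, S x); last first.
  rewrite (_ : S = set0) ?measure0 ?lee_fin ?mulr_ge0//.
  by apply/seteqP; split=> // y /S0.
have mS' : measurable (@prod_to_complex R @^-1` S).
  by rewrite -[X in measurable X]setTI; exact: measurable_prod_to_complex.
rewrite lebesgue_CE.
have := @product_measure_le_ysection _ _ _ _ _ leb leb _ `[x2 - b, x2 + b]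
  (2 * m) mS'.
move=> /(_ (measurable_itv _) (mulr_ge0 (ler0n _ 2) m0)) => H; apply: (le_trans (H _ _)) => {H}.
- by move=> y1 y2 /(Sb _ _ Sx) /=; rewrite in_itv /= ler_distlC.
- move=> y _; apply: lebesgue_le_diam => //; first exact: measurable_ysection.
  by move=> u v; rewrite /ysection /= !inE => uS vS; exact: (Sm _ _ uS vS).
by rewrite [X in (_ * X)%E]lebesgue_itv_radius// -EFinM lee_fin; lra.
Qed.

Lemma lebesgue_C_le_Im (S : set R[i]) (b m : R) : measurable S -> 0 <= b -> 0 <= m ->
  (forall x y, S x -> S y -> `|complex.Re x - complex.Re y| <= b) ->
  (forall x y, S x -> S y -> complex.Re x = complex.Re y ->
     `|complex.Im x - complex.Im y| <= m) ->
  (lebesgue_C S <= (4 * b * m)%:E)%E.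
Proof.
move=> mS b0 m0 Sb Sm.
have [[[x1 x2] Sx]|/forallNP S0] := pselect (exists x, S x); last first.
  rewrite (_ : S = set0) ?measure0 ?lee_fin ?mulr_ge0//.
  by apply/seteqP; split=> // y /S0.
have mS' : measurable (@prod_to_complex R @^-1` S).
  by rewrite -[X in measurable X]setTI; exact: measurable_prod_to_complex.
rewrite lebesgue_CE.
have := @product_measure_le_xsection _ _ _ _ _ leb leb _ `[x1 - b, x1 + b]
  (2 * m) mS'.
move=> /(_ (measurable_itv _) (mulr_ge0 (ler0n _ 2) m0)) => H; apply: (le_trans (H _ _)) => {H}.
- by move=> y1 y2 /(Sb _ _ Sx) /=; rewrite in_itv /= ler_distlC.
- move=> y _; apply: lebesgue_le_diam => //; first exact: measurable_xsection.
  by move=> u v; rewrite /xsection /= !inE => uS vS; exact: (Sm _ _ uS vS).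
by rewrite [X in (_ * X)%E]lebesgue_itv_radius// -EFinM lee_fin; lra.
Qed.

Definition csquare_at (c : R[i]) (e : R) : set R[i] := [set a |
  `|complex.Re a - complex.Re c| <= e /\ `|complex.Im a - complex.Im c| <= e].

Lemma measurable_Re : measurable_fun setT (@complex.Re R).
Proof. exact: (measurableT_comp measurable_fst (@measurable_complex_to_prod R)). Qed.

Lemma measurable_Im : measurable_fun setT (@complex.Im R).
Proof. exact: (measurableT_comp measurable_snd (@measurable_complex_to_prod R)). Qed.

Lemma csquare_atE (c : R[i]) (e : R) : @prod_to_complex R @^-1` csquare_at c e =
  `[complex.Re c - e, complex.Re c + e] `*` `[complex.Im c - e, complex.Im c + e].
Proof.
apply/seteqP; split=> -[x y]; rewrite /csquare_at /= !in_itv /= !ler_distl;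
  by move=> [-> ->].
Qed.

Lemma measurable_csquare_at (c : R[i]) (e : R) : measurable (csquare_at c e).
Proof.
rewrite (_ : csquare_at c e = @complex_to_prod R @^-1`
    (@prod_to_complex R @^-1` csquare_at c e)); last first.
  by apply/seteqP; split=> -[].
rewrite -[X in measurable X]setTI; apply: measurable_complex_to_prod => //.
by rewrite csquare_atE; apply: measurableX; exact: measurable_itv.
Qed.

Lemma lebesgue_csquare_at (c : R[i]) (e : R) : 0 < e ->
  lebesgue_C (csquare_at c e) = ((2 * e) ^+ 2)%:E.
Proof.
move=> e0; rewrite lebesgue_CE csquare_atE product_measure1E//=;
  do ?exact: measurable_itv.
by rewrite !lebesgue_itv_radius ?ltW// -EFinM -expr2.
Qed.

End plane_measure.

(** * Slicing of Lebesgue measure on C^n *)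

Section slices_Cn.
Variable R : realType.

Definition set_coord n (v : n.-tuple R[i]) (j : 'I_n) (a : R[i]) : n.-tuple R[i] :=
  [tuple if k == j then a else tnth v k | k < n].

Lemma tnth_set_coord n (v : n.-tuple R[i]) j a k :
  tnth (set_coord v j a) k = if k == j then a else tnth v k.
Proof. by rewrite tnth_mktuple. Qed.

Lemma measurable_set_coord n (v : n.-tuple R[i]) j :
  measurable_fun setT (set_coord v j).
Proof.
apply/measurable_fun_tnthP => k.
rewrite (_ : _ \o _ = fun a => if k == j then a else tnth v k); last first.
  by apply/funext => a /=; rewrite tnth_set_coord.
by case: (k == j).
Qed.

Lemma set_coord_cons0 n (a b : R[i]) (v : n.-tuple R[i]) :
  set_coord (tuple_cons (a, v)) ord0 b = tuple_cons (b, v).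
Proof.
apply: eq_from_tnth => k; rewrite tnth_set_coord.
by case: (unliftP ord0 k) => [i ->|->]; rewrite ?eqxx//= !tnthS.
Qed.

Lemma set_coord_consS n (a b : R[i]) (v : n.-tuple R[i]) j :
  set_coord (tuple_cons (a, v)) (lift ord0 j) b = tuple_cons (a, set_coord v j b).
Proof.
apply: eq_from_tnth => k; rewrite tnth_set_coord.
case: (unliftP ord0 k) => [i ->|->]; last by [].
by rewrite (inj_eq lift_inj) !tnthS tnth_set_coord.
Qed.

Definition polybox n (Q : 'I_n -> set R[i]) : set (n.-tuple R[i]) :=
  [set v | forall k, Q k (tnth v k)].

Lemma measurable_polybox n (Q : 'I_n -> set R[i]) : (forall k, measurable (Q k)) ->
  measurable (polybox Q).
Proof.
move=> mQ; rewrite (_ : polybox Q =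
    \bigcap_(j in [set: 'I_n]) ((@tnth n R[i] ^~ j) @^-1` Q j)).
  apply: fin_bigcap_measurable => // j _; rewrite -[X in measurable X]setTI.
  exact: measurable_tnth.
by apply/seteqP; split=> v /= h j; [move=> _|]; exact: h.
Qed.

Lemma polybox_cons n (Q : 'I_n.+1 -> set R[i]) :
  @tuple_cons R n @^-1` polybox Q =
  Q ord0 `*` polybox (fun k => Q (lift ord0 k)).
Proof.
apply/seteqP; split=> -[a v] /=.
  move=> h; split; first exact: (h ord0).
  by move=> j; have := h (lift ord0 j); rewrite tnthS.
move=> [ha hv] j; case: (unliftP ord0 j) => [i ->|->]//.
by rewrite tnthS; exact: hv.
Qed.

Lemma lebesgue_Cn_consE n (S : set (n.+1.-tuple R[i])) :
  lebesgue_Cn R n.+1 S =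
  (@lebesgue_C R \x lebesgue_Cn R n)%E (@tuple_cons R n @^-1` S).
Proof. by []. Qed.

Lemma lebesgue_polybox n (Q : 'I_n -> set R[i]) (q : 'I_n -> R) :
  (forall k, measurable (Q k)) -> (forall k, lebesgue_C (Q k) = (q k)%:E) ->
  lebesgue_Cn R n (polybox Q) = (\prod_(k < n) q k)%:E.
Proof.
elim: n => [|n ih] in Q q * => mQ Qq.
  by rewrite /= diracE big_ord0 mem_set// => -[].
rewrite lebesgue_Cn_consE polybox_cons product_measure1E//; last first.
  exact: measurable_polybox.
rewrite big_ord_recl EFinM; congr mule; first exact: Qq.
exact: (ih _ (fun k => q (lift ord0 k))).
Qed.

(** Fubini with the [j]-th coordinate innermost, while the other [n] coordinates sweep sets of area
    [q]. If [j] is the head, it is integrated first and the tail is confined to a box; otherwise the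
    head is one of the confined coordinates, and the induction hypothesis applies to the section at
    a fixed head. *)
Lemma lebesgue_Cn_le_slice n (j : 'I_n.+1) (S : set (n.+1.-tuple R[i]))
    (Q : 'I_n.+1 -> set R[i]) (q c : R) :
  measurable S -> (forall k, measurable (Q k)) ->
  (forall k, lebesgue_C (Q k) = q%:E) -> 0 <= q -> 0 <= c ->
  (forall v, S v -> forall k, k != j -> Q k (tnth v k)) ->
  (forall v, (lebesgue_C [set a | S (set_coord v j a)] <= c%:E)%E) ->
  (lebesgue_Cn R n.+1 S <= (c * q ^+ n)%:E)%E.
Proof.
elim: n => [|n ih] in j S Q * => mS mQ Qq q0 c0 SQ Sc.
all: rewrite lebesgue_Cn_consE.
all: have mS' : measurable (@tuple_cons R _ @^-1` S) by
  rewrite -[X in measurable X]setTI; exact: measurable_tuple_cons.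
(* In dimension one [j] can only be the head, which leaves three goals. *)
all: case: (unliftP ord0 j) => [i ji|j0]; first (try by case: i ji).
- have := @product_measure_le_ysection _ _ _ _ _ (@lebesgue_C R)
    (lebesgue_Cn R 0) _ setT c mS' measurableT c0.
  move=> H; apply: le_trans; first apply: H => //.
    move=> v _; have := Sc (tuple_cons (0, v)); apply: le_trans.
    rewrite (_ : ysection _ _ = [set a | S (set_coord (tuple_cons (0, v)) j a)])//.
    by apply/seteqP; split => a /=; rewrite /ysection /= inE /= j0 set_coord_cons0.
  by rewrite /= diracT mule1 expr0 mulr1.
- have := @product_measure_le_xsection _ _ _ _ _ (@lebesgue_C R)
    (lebesgue_Cn R n.+1) _ (Q ord0) (c * q ^+ n) mS' (mQ _).
  move=> H; apply: le_trans; first apply: H => //.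
  + by rewrite mulr_ge0// exprn_ge0.
  + by move=> x v /SQ /(_ ord0); rewrite ji; apply.
  + move=> x _; apply: (ih i _ (fun k => Q (lift ord0 k))) => //.
    * exact: measurable_xsection.
    * move=> v; rewrite /xsection /= inE /= => /SQ h k ki.
      have := h (lift ord0 k); rewrite ji tnthS; apply.
      by rewrite (inj_eq lift_inj).
    * move=> v; have := Sc (tuple_cons (x, v)); apply: le_trans.
      rewrite (_ : [set a | xsection _ _ _] =
        [set a | S (set_coord (tuple_cons (x, v)) j a)])//.
      by apply/seteqP; split => a /=; rewrite /xsection /= inE /= ji set_coord_consS.
  + by rewrite [X in (_ * X)%E]Qq -EFinM exprSr mulrA.
- have := @product_measure_le_ysection _ _ _ _ _ (@lebesgue_C R)
    (lebesgue_Cn R n.+1) _ (polybox (fun k => Q (lift ord0 k))) c mS'.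
  move=> H; apply: le_trans; first apply: H => //.
  + exact: measurable_polybox.
  + move=> x v /SQ h k; have := h (lift ord0 k); rewrite j0 tnthS; exact.
  + move=> v _; have := Sc (tuple_cons (0, v)); apply: le_trans.
    rewrite (_ : ysection _ _ = [set a | S (set_coord (tuple_cons (0, v)) j a)])//.
    by apply/seteqP; split => a /=; rewrite /ysection /= inE /= j0 set_coord_cons0.
  + rewrite (@lebesgue_polybox _ _ (fun=> q))// -EFinM.
    by rewrite prodr_const card_ord.
Qed.

End slices_Cn.

(** * Measurability of the geometric quantities and of the regions *)

Section measurability.
Variables (R : realType) (N : nat).
Local Notation CN := (N.-tuple R[i]).
Context d (T : measurableType d).
Implicit Types F G : T -> CN.

Lemma measurable_Re_tnth F j : measurable_fun setT F ->
  measurable_fun setT (fun x => complex.Re (tnth (F x) j)).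
Proof.
move=> mF; apply: (measurableT_comp (@measurable_Re R)).
exact: (measurableT_comp (@measurable_tnth _ _ N j)).
Qed.

Lemma measurable_Im_tnth F j : measurable_fun setT F ->
  measurable_fun setT (fun x => complex.Im (tnth (F x) j)).
Proof.
move=> mF; apply: (measurableT_comp (@measurable_Im R)).
exact: (measurableT_comp (@measurable_tnth _ _ N j)).
Qed.

Lemma measurable_Re_cdot F G : measurable_fun setT F -> measurable_fun setT G ->
  measurable_fun setT (fun x => complex.Re (cdot (F x) (G x))).
Proof.
move=> mF mG; under eq_fun do rewrite cRe_sum; apply: measurable_sum => j.
under eq_fun do rewrite cReM cReJ cImJ mulrN opprK.
by apply: measurable_funD; apply: measurable_funM;
  (exact: measurable_Re_tnth || exact: measurable_Im_tnth).
Qed.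

Lemma measurable_Im_cdot F G : measurable_fun setT F -> measurable_fun setT G ->
  measurable_fun setT (fun x => complex.Im (cdot (F x) (G x))).
Proof.
move=> mF mG; under eq_fun do rewrite cIm_sum; apply: measurable_sum => j.
under eq_fun do rewrite cImM cReJ cImJ mulrN.
apply: measurable_funD; first apply: measurableT_comp => //;
  by apply: measurable_funM; (exact: measurable_Re_tnth || exact: measurable_Im_tnth).
Qed.

Lemma measurable_normc (g : T -> R[i]) (D : set T) :
  measurable_fun D (@complex.Re R \o g) -> measurable_fun D (@complex.Im R \o g) ->
  measurable_fun D (fun x => normc (g x)).
Proof.
move=> mRe mIm.
rewrite (_ : (fun x => _) = (fun x => Num.sqrt
   ((@complex.Re R \o g) x ^+ 2 + (@complex.Im R \o g) x ^+ 2))); last first.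
  by apply/funext => x /=; case: (g x).
apply: measurableT_comp.
  by apply: continuous_measurable_fun; exact: sqrt_continuous.
by apply: measurable_funD; apply: measurable_funX.
Qed.

Lemma measurable_rho F G : measurable_fun setT F -> measurable_fun setT G ->
  measurable_fun setT (fun x => rho (F x) (G x)).
Proof.
move=> mF mG; apply: measurable_normc.
  rewrite (_ : _ \o _ = fun x => complex.Re (1 : R[i]) - complex.Re (cdot (F x) (G x))); last first.
    by apply/funext => x; rewrite -cReN -cReD.
  by apply: measurable_funB => //; exact: measurable_Re_cdot.
rewrite (_ : _ \o _ = fun x => complex.Im (1 : R[i]) - complex.Im (cdot (F x) (G x))); last first.
  by apply/funext => x; rewrite -cImN -cImD.
by apply: measurable_funB => //; exact: measurable_Im_cdot.
Qed.

Lemma measurable_delta F : measurable_fun setT F ->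
  measurable_fun setT (fun x => delta (F x)).
Proof.
move=> mF; under eq_fun do rewrite /delta cnorm_sqr.
by apply: measurable_funB => //; exact: measurable_Re_cdot.
Qed.

End measurability.

Section measurable_regions.
Variables (R : realType) (N : nat).
Local Notation CN := (N.-tuple R[i]).
Local Notation B := (@cball R N).

Lemma measurable_ltr_set d (T : measurableType d) (f : T -> R) (a : R) :
  measurable_fun setT f -> measurable [set x | f x < a].
Proof.
move=> mf; rewrite (_ : [set x | _] = setT `&` f @^-1` `]-oo, a[%classic).
  by apply: mf => //; exact: measurable_itv.
by apply/seteqP; split => x /=; rewrite in_itv /= ?andbT; [|case].
Qed.

Lemma measurable_ler_set d (T : measurableType d) (f : T -> R) (a : R) :
  measurable_fun setT f -> measurable [set x | a <= f x].
Proof.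
move=> mf; rewrite (_ : [set x | _] = setT `&` f @^-1` `[a, +oo[%classic).
  by apply: mf => //; exact: measurable_itv.
by apply/seteqP; split => x /=; rewrite in_itv /= ?andbT; [|case].
Qed.

Definition qball (z : CN) (r : R) : set CN := [set w | B w /\ rho z w < r].

Lemma measurable_qball z r : measurable (qball z r).
Proof.
apply: measurableI; first exact: measurable_cball.
exact/measurable_ltr_set/measurable_rho.
Qed.

Definition shell (z : CN) (r h : R) : set CN := qball z r `&` [set w | delta w < h].

Lemma measurable_shell z r h : measurable (shell z r h).
Proof.
apply: measurableI; first exact: measurable_qball.
exact/measurable_ltr_set/measurable_delta.
Qed.

End measurable_regions.

(** * Unweighted volume of the shells *)

Section shell_volume.
Variable R : realType.

Definition cpart (b : bool) (a : R[i]) : R :=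
  if b then complex.Re a else complex.Im a.

Lemma measurable_cpart b : measurable_fun setT (cpart b).
Proof. by case: b; [exact: measurable_Re|exact: measurable_Im]. Qed.

Lemma cpart_normc_le b a : `|cpart b a| <= normc a.
Proof. by case: b; [exact: normr_Re_le|exact: normr_Im_le]. Qed.

Lemma cpartB b (x y : R[i]) : cpart b (x - y) = cpart b x - cpart b y.
Proof. by case: b => /=; rewrite ?cReD ?cImD ?cReN ?cImN. Qed.

Lemma normc_sqr_cpart b (a : R[i]) :
  normc a ^+ 2 = cpart b a ^+ 2 + cpart (~~ b) a ^+ 2.
Proof. by rewrite normc_sqr; case: b => //=; rewrite addrC. Qed.

(* on a set where one real coordinate stays away from 0, |a|^2 controls that
   coordinate once the other one is fixed, whence a bound linear in h *)
Lemma lebesgue_C_annulus_le (c m h : R) (S : set R[i]) (b s : bool) :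
  0 < c -> 0 <= m -> 0 <= h -> measurable S ->
  (forall x, S x -> c <= (-1) ^+ s * cpart b x) ->
  (forall x y, S x -> S y -> `|cpart (~~ b) x - cpart (~~ b) y| <= m) ->
  (forall x y, S x -> S y -> `|normc x ^+ 2 - normc y ^+ 2| <= h) ->
  (lebesgue_C S <= (4 * m * (h / (2 * c)))%:E)%E.
Proof.
move=> c0 m0 h0 mS Sc Sm Sh.
have hc0 : 0 <= h / (2 * c) by rewrite divr_ge0// mulr_ge0// ltW.
have key x y : S x -> S y -> cpart (~~ b) x = cpart (~~ b) y ->
    `|cpart b x - cpart b y| <= h / (2 * c).
  move=> Sx Sy xy; have := Sh _ _ Sx Sy.
  rewrite !(normc_sqr_cpart b) xy opprD addrACA subrr addr0 subr_sqr normrM.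
  have : 2 * c <= `|cpart b x + cpart b y|.
    have := lerD (Sc _ Sx) (Sc _ Sy); rewrite -mulrDr -mulr2n mulr_natl.
    by move/le_trans; apply; rewrite (le_trans (ler_norm _))// normrMsign.
  move=> h1 h2; rewrite ler_pdivlMr ?mulr_gt0//.
  by apply: le_trans h2; rewrite ler_wpM2l.
case: b {Sc Sh} Sm key => /= Sm key.
  exact: lebesgue_C_le_Re.
exact: lebesgue_C_le_Im.
Qed.

Lemma normc_coord_le n (z w : n.-tuple R[i]) j :
  normc (tnth z j - tnth w j) ^+ 2 <= sqdist z w.
Proof.
by rewrite /sqdist (bigD1 j)//= lerDl sumr_ge0// => k _; rewrite sqr_ge0.
Qed.

Lemma delta_set_coord n (v : n.-tuple R[i]) j (a b : R[i]) :
  delta (set_coord v j a) - delta (set_coord v j b) = normc b ^+ 2 - normc a ^+ 2.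
Proof.
have E x : delta (set_coord v j x) =
    1 - (normc x ^+ 2 + \sum_(k < n | k != j) normc (tnth v k) ^+ 2).
  rewrite deltaE (bigD1 j)//= tnth_set_coord eqxx; congr (_ - (_ + _)).
  by apply: eq_bigr => k kj; rewrite tnth_set_coord (negPf kj).
by rewrite !E; ring.
Qed.

Lemma cdot_set_coord n (v z : n.-tuple R[i]) j (a b : R[i]) :
  cdot (set_coord v j a) z - cdot (set_coord v j b) z = (a - b) * conjc (tnth z j).
Proof.
rewrite /cdot -sumrB (bigD1 j)//= !tnth_set_coord eqxx -mulrBl big1 ?addr0// => k kj.
by rewrite !tnth_set_coord (negPf kj) subrr.
Qed.

(** If all real coordinates were below c = (4 (n + 1))^-1 in absolute value, then |z|^2 <= 2 (n + 1)
    c^2 = c / 2 <= 1/8, against |z|^2 >= 1/2. This replaces a rotation of z onto the first axis. *)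
Lemma large_coordinate n (z : n.+1.-tuple R[i]) : delta z <= 2^-1 ->
  exists j b s, (4 * n.+1%:R)^-1 <= (-1) ^+ (s : bool) * cpart b (tnth z j).
Proof.
move=> dz; set c := (4 * n.+1%:R)^-1.
have c0 : 0 < c by rewrite invr_gt0.
apply: contrapT => /forallNP H.
have small j b : `|cpart b (tnth z j)| < c.
  have {}H s : (-1) ^+ (s : bool) * cpart b (tnth z j) < c.
    by rewrite ltNge; apply/negP => h; apply: (H j); exists b, s.
  rewrite ltr_norml; have := H true; have := H false.
  by rewrite expr0 expr1 mul1r mulN1r; lra.
have : 1 - delta z <= \sum_(j < n.+1) (c ^+ 2 + c ^+ 2).
  rewrite deltaE opprB addrC subrK; apply: ler_sum => j _.
  rewrite (normc_sqr_cpart true) -!(@real_normK _ (cpart _ _)) ?num_real//.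
  by rewrite lerD// ler_pXn2r ?nnegrE// ltW.
rewrite sumr_const card_ord -mulr_natl -mulr2n -mulr_natl expr2.
have nc : n.+1%:R * c = 4^-1 by rewrite /c invfM mulrCA mulfV ?mulr1.
have c4 : c <= 4^-1 by rewrite /c lef_pV2 ?posrE// ler_peMr// ler1n.
move: nc c4 c0 dz; set k := n.+1%:R; nra.
Qed.

End shell_volume.

Section shell_volume_bound.
Variables (R : realType) (n : nat).
Local Notation CN := (n.+1.-tuple R[i]).
Local Notation B := (@cball R n.+1).
Implicit Types z w v : CN.

(** The index [i] records the coordinate, the choice of its real ([true]) or imaginary part, and the
    sign ([true] for negative) for which [large_coordinate] gives a lower bound. *)
Definition shell_piece z (r h c : R) (i : 'I_n.+1 * bool * bool) : set CN :=
  shell z r h `&` [set w | c <= (-1) ^+ i.2 * cpart i.1.2 (tnth w i.1.1)].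

Lemma measurable_shell_piece z (r h c : R) i : measurable (shell_piece z r h c i).
Proof.
apply: measurableI; first exact: measurable_shell.
apply: measurable_ler_set; apply: measurable_funM => //.
by apply: (measurableT_comp (@measurable_cpart R _)); exact: measurable_tnth.
Qed.

(** On a slice in the distinguished coordinate [delta] stays between 0 and [h], so |x|^2 varies by
    at most [h] there and the annulus bound is linear in [h]. The squares around the coordinates of
    [w] account for the other [n] coordinates. *)
Lemma shell_piece_volume z (r h c : R) i (w : CN) (e m : R) :
  0 < c -> 0 < e -> 0 <= m -> 0 < h ->
  (forall v, shell_piece z r h c i v ->
    forall k, k != i.1.1 -> csquare_at (tnth w k) e (tnth v k)) ->
  (forall v x y, shell_piece z r h c i (set_coord v i.1.1 x) ->
    shell_piece z r h c i (set_coord v i.1.1 y) ->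
    `|cpart (~~ i.1.2) x - cpart (~~ i.1.2) y| <= m) ->
  (lebesgue_Cn R n.+1 (shell_piece z r h c i) <=
   (4 * m * (h / (2 * c)) * (2 * e) ^+ 2 ^+ n)%:E)%E.
Proof.
move=> c0 e0 m0 h0 Se Sm.
apply: (@lebesgue_Cn_le_slice _ _ i.1.1 _ (fun k => csquare_at (tnth w k) e)) => //.
- exact: measurable_shell_piece.
- by move=> k; exact: measurable_csquare_at.
- by move=> k; rewrite lebesgue_csquare_at.
- by rewrite exprn_ge0// mulr_ge0// ltW.
- by rewrite !mulr_ge0 ?invr_ge0 ?mulr_ge0// ltW.
- move=> v; apply: (@lebesgue_C_annulus_le _ c m h _ i.1.2 i.2) => //.
  + exact: ltW.
  + rewrite -[X in measurable X]setTI; apply: measurable_set_coord => //.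
    exact: measurable_shell_piece.
  + by move=> x [_] /=; rewrite tnth_set_coord eqxx.
  + by move=> x y Sx Sy; exact: (Sm _ _ _ Sx Sy).
  + move=> x y [[[/delta_gt0 dx _] /= hx] _] [[[/delta_gt0 dy _] /= hy] _].
    by have := delta_set_coord v i.1.1 y x; rewrite ler_norml; lra.
Qed.

(** Quasi-balls are anisotropic. The other coordinates vary by O(sqrt r), hence in an area O(r)
    each, but the distinguished one varies only by O(r): moving it by x - y moves <v, z> by (x - y)
    conj(z_j), and |z_j| is bounded below. With the height this gives r^n r h. *)
Lemma shell_piece_volume_small z (r h c : R) i : B z -> 0 < c -> 0 < r -> 0 < h ->
  r <= c ^+ 2 / 8 ->
  (lebesgue_Cn R n.+1 (shell_piece z r h c i) <=
   (8 / c ^+ 2 * 8 ^+ n * r ^+ n.+1 * h)%:E)%E.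
Proof.
move=> Bz c0 r0 h0 rc.
have r2 : 0 < 2 * r by rewrite mulr_gt0.
have coord v k : shell_piece z r h c i v -> normc (tnth v k - tnth z k) ^+ 2 < 2 * r.
  move=> [[[Bv rv] _] _]; apply: le_lt_trans (normc_coord_le _ _ _) _.
  by apply: le_lt_trans (sqdist_le_rho Bv Bz) _; rewrite ltr_pM2l// rhoC.
have := @shell_piece_volume z r h c i z (Num.sqrt (2 * r)) (4 * r / c) c0.
have -> : (2 * Num.sqrt (2 * r)) ^+ 2 = 8 * r.
  by rewrite exprMn sqr_sqrtr ?ltW//; ring.
rewrite [X in (_ <= X%:E)%E](_ : _ = 8 / c ^+ 2 * 8 ^+ n * r ^+ n.+1 * h); last first.
  rewrite (exprS r n) [(8 * r) ^+ n]exprMn. by field; rewrite gt_eqF.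
apply => //.
- by rewrite sqrtr_gt0.
- by rewrite divr_ge0 ?mulr_ge0// ltW.
- move=> v Sv k _; have := ltW (coord v k Sv).
  rewrite -[in X in _ <= X -> _](sqr_sqrtr (ltW r2)) ler_pXn2r ?nnegrE ?normc_ge0 ?sqrtr_ge0//.
  by move=> le; split; apply: le_trans le;
    [have := normr_Re_le (tnth v k - tnth z k); rewrite cReD cReN
    |have := normr_Im_le (tnth v k - tnth z k); rewrite cImD cImN].
move=> v x y Sx Sy.
rewrite -cpartB; apply: le_trans (cpart_normc_le _ _) _.
(* The two coordinates differ by less than sqrt (2 r), and [r <= c ^+ 2 / 8] says precisely that
   sqrt (2 r) <= c / 2. *)
have zc : c / 2 <= normc (tnth z i.1.1).
  have := coord _ i.1.1 Sx; rewrite tnth_set_coord eqxx => h1.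
  have h2 : normc (x - tnth z i.1.1) < c / 2.
    rewrite -(@ltr_pXn2r _ 2)// ?nnegrE ?normc_ge0 ?divr_ge0 ?ltW//.
    by apply: lt_le_trans h1 _; rewrite expr_div_n; lra.
  have h3 : c <= normc x.
    case: Sx => _ /=; rewrite tnth_set_coord eqxx => /le_trans; apply.
    by rewrite (le_trans (ler_norm _))// normrMsign cpart_normc_le.
  by have := normcD_le (x - tnth z i.1.1) (tnth z i.1.1); rewrite subrK; lra.
have : normc (x - y) * normc (tnth z i.1.1) <= 2 * r.
  rewrite -[normc (tnth _ _)]normcJ_eq -ComplexField.Normc.normcM -(cdot_set_coord v).
  move: Sx Sy => [[[_ h1] _] _] [[[_ h2] _] _].
  rewrite rhoC /rho in h1; rewrite rhoC /rho in h2.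
  have := normcB_le (1 - cdot (set_coord v i.1.1 y) z) (1 - cdot (set_coord v i.1.1 x) z).
  set cx := cdot (set_coord v i.1.1 x) z in h1 *.
  set cy := cdot (set_coord v i.1.1 y) z in h2 *.
  by rewrite (_ : 1 - cy - (1 - cx) = cx - cy); [lra|ring].
move=> h1; rewrite ler_pdivlMr//.
have := normc_ge0 (x - y); nra.
Qed.

Lemma shell_piece_volume_large z (r h c : R) i : 0 < c -> 0 < h ->
  (lebesgue_Cn R n.+1 (shell_piece z r h c i) <= (4 / c * 4 ^+ n * h)%:E)%E.
Proof.
move=> c0 h0.
have := @shell_piece_volume z r h c i [tuple 0 | k < n.+1] 1 2 c0.
rewrite mulr1 [X in (_ <= X%:E)%E](_ : _ = 4 / c * 4 ^+ n * h); last first.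
  have -> : 2 ^+ 2 = 4 :> R by ring.
  by field; rewrite gt_eqF.
have coord v k b : shell_piece z r h c i v -> `|cpart b (tnth v k)| <= 1.
  move=> [[[/delta_gt0 + _] _] _]; rewrite deltaE (bigD1 k)//= => dv.
  apply: le_trans (cpart_normc_le _ _) _.
  rewrite -(@ler_pXn2r _ 2)// ?nnegrE ?normc_ge0// expr1n.
  have : 0 <= \sum_(j < n.+1 | j != k) normc (tnth v j) ^+ 2.
    by rewrite sumr_ge0// => j _; rewrite sqr_ge0.
  by lra.
apply => //.
- move=> v Sv k _; rewrite /csquare_at /= tnth_mktuple /= !subr0.
  by split; [exact: (coord v k true)|exact: (coord v k false)].
- move=> v x y Sx Sy; rewrite (le_trans (ler_normB _ _))//.
  have := coord _ i.1.1 (~~ i.1.2) Sx; have := coord _ i.1.1 (~~ i.1.2) Sy.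
  by rewrite !tnth_set_coord eqxx; lra.
Qed.

Lemma shell_volume_pieces z (r h p : R) :
  (forall w, shell z r h w -> delta w <= 2^-1) ->
  (forall i, lebesgue_Cn R n.+1 (shell_piece z r h (4 * n.+1%:R)^-1 i) <= p%:E)%E ->
  (lebesgue_Cn R n.+1 (shell z r h) <= (p *+ #|{: 'I_n.+1 * bool * bool}|)%:E)%E.
Proof.
move=> hd hp; apply: le_trans.
  apply: (@measure_le_sum_cover _ _ _ (lebesgue_Cn R n.+1) _
    (index_enum ('I_n.+1 * bool * bool)%type) (shell_piece z r h (4 * n.+1%:R)^-1)).
  - exact: measurable_shell.
  - by move=> i; exact: measurable_shell_piece.
  - move=> w Sw; have [j [b [s H]]] := large_coordinate (hd _ Sw).
    by exists (j, b, s); rewrite ?mem_index_enum.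
apply: (@le_trans _ _ (\sum_(i : 'I_n.+1 * bool * bool) p%:E)%E).
  by apply: lee_sum => i _; exact: hp.
by rewrite sumEFin sumr_const.
Qed.

(** Three regimes. For [r <= r0] the bound delta(w) <= 2 rho(w, z) keeps the shell away from the
    origin and the anisotropic estimate applies. For larger [r] the power of [r] is bounded below,
    so O(h) suffices: it comes from the crude pieces when h <= 1/2 and from the volume of the whole
    ball otherwise. *)
Lemma shell_volume : exists2 C : R, 0 < C & forall z (r h : R), B z -> 0 < r -> 0 < h ->
  (lebesgue_Cn R n.+1 (shell z r h) <= (C * r ^+ n.+1 * h)%:E)%E.
Proof.
pose c : R := (4 * n.+1%:R)^-1; pose r0 : R := c ^+ 2 / 8.
have c0 : 0 < c by rewrite invr_gt0.
have c1 : c <= 4^-1 by rewrite /c lef_pV2 ?posrE// ler_peMr// ler1n.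
have c21 : c ^+ 2 <= 1 by rewrite exprn_ile1 ?ltW//; lra.
have r01 : r0 <= 8^-1 by rewrite /r0 ler_pdivrMr// mulVf.
have r00 : 0 < r0 by rewrite divr_gt0// exprn_gt0.
pose k := #|{: 'I_n.+1 * bool * bool}|.
pose V := fine (lebesgue_Cn R n.+1 B).
have Vfin : lebesgue_Cn R n.+1 B \is a fin_num.
  by rewrite ge0_fin_numE ?measure_ge0 ?lebesgue_cball_lty.
have V0 : 0 <= V by rewrite fine_ge0.
pose C1 : R := (8 / c ^+ 2 * 8 ^+ n) *+ k.
pose C2 : R := (4 / c * 4 ^+ n) *+ k + 2 * V.
have C10 : 0 <= C1 by rewrite mulrn_wge0// !mulr_ge0 ?invr_ge0 ?exprn_ge0// ltW.
have C20 : 0 <= C2.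
  by rewrite addr_ge0 ?mulr_ge0// mulrn_wge0// !mulr_ge0 ?invr_ge0 ?exprn_ge0// ltW.
have C3 : 0 <= C2 / r0 ^+ n.+1 by rewrite divr_ge0// exprn_ge0// ltW.
exists (C1 + C2 / r0 ^+ n.+1 + 1) => [|z r h Bz rgt0 h0]; first by lra.
have rn0 : 0 <= r ^+ n.+1 by rewrite exprn_ge0// ltW.
have rh0 : 0 <= r ^+ n.+1 * h by rewrite mulr_ge0// ltW.
have [rr0|r0r] := leP r r0.
  apply: le_trans.
    apply: (@shell_volume_pieces _ _ _ (8 / c ^+ 2 * 8 ^+ n * r ^+ n.+1 * h)) => //.
      move=> w [[Bw rw] _]; have := delta_le_rho w Bz; rewrite rhoC => dw.
      by lra.
    by move=> i; exact: shell_piece_volume_small.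
  rewrite -/k lee_fin -2!mulrnAl -/C1 -!(mulrA _ (r ^+ n.+1)) ler_wpM2r//; lra.
have rr : 1 <= r ^+ n.+1 / r0 ^+ n.+1.
  by rewrite -expr_div_n exprn_ege1// ler_pdivlMr// mul1r ltW.
suff : (lebesgue_Cn R n.+1 (shell z r h) <= (C2 * h)%:E)%E.
  move/le_trans; apply; rewrite lee_fin.
  apply: (@le_trans _ _ (C2 * h * (r ^+ n.+1 / r0 ^+ n.+1))).
    by rewrite ler_peMr// mulr_ge0// ltW.
  rewrite [leLHS](_ : _ = C2 / r0 ^+ n.+1 * (r ^+ n.+1 * h)); last by ring.
  rewrite -[leRHS]mulrA ler_wpM2r//; lra.
have [h2|h2] := leP h 2^-1.
  apply: le_trans.
    apply: (@shell_volume_pieces _ _ _ (4 / c * 4 ^+ n * h)) => //.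
      by move=> w [_] /= wh; rewrite (le_trans (ltW wh)).
    by move=> i; exact: shell_piece_volume_large.
  rewrite -/k lee_fin -mulrnAl /C2 (mulrDl _ (2 * V)) lerDl; nra.
apply: (@le_trans _ _ (lebesgue_Cn R n.+1 B)).
  apply: le_measure; rewrite ?inE; [exact: measurable_shell|exact: measurable_cball|].
  by move=> w [[]].
rewrite -(fineK Vfin) -/V lee_fin /C2 (mulrDl _ (2 * V)).
have : 0 <= (4 / c * 4 ^+ n) *+ k * h.
  by rewrite mulr_ge0 ?(ltW h0)// mulrn_wge0// !mulr_ge0 ?invr_ge0 ?exprn_ge0// ltW.
by nra.
Qed.

End shell_volume_bound.

(** * Dyadic scales and the weighted volume of the shells *)

Section real_scales.
Variable R : realType.
Implicit Types x y h K a : R.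

(** Two-sided comparability means |ln x - ln y| <= ln K, which bounds the quotient of the powers for
    either sign of [a]. *)
Lemma powR_le_comparable K x y a : 1 <= K -> 0 < x -> 0 < y ->
  x <= K * y -> y <= K * x -> y `^ a <= K `^ `|a| * x `^ a.
Proof.
move=> K1 x0 y0 xy yx.
have K0 : 0 < K by rewrite (lt_le_trans ltr01).
rewrite /powR !gt_eqF// -expRD ler_expR.
have lxy : ln x <= ln K + ln y.
  by rewrite -lnM ?posrE// ler_ln ?posrE// mulr_gt0.
have lyx : ln y <= ln K + ln x.
  by rewrite -lnM ?posrE// ler_ln ?posrE// mulr_gt0.
rewrite -lerBlDr -mulrBr (le_trans (ler_norm _))// normrM ler_wpM2l//.
by rewrite ler_norml; lra.
Qed.

Lemma powR_exp x a n : 0 <= x -> (x ^+ n) `^ a = (x `^ a) ^+ n.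
Proof.
by move=> x0; rewrite -powR_mulrn// -powRrM mulrC powRrM powR_mulrn// powR_ge0.
Qed.

Lemma half_powR_lt1 a : 0 < a -> 2^-1 `^ a < 1 :> R.
Proof.
move=> a0; rewrite /powR gt_eqF// lnV ?posrE// mulrN expR_lt1 oppr_lt0.
by rewrite mulr_gt0// ln_gt0// ltr1n.
Qed.

Lemma geometric_sum_le x n : 0 <= x -> x < 1 -> \sum_(i < n) x ^+ i <= (1 - x)^-1.
Proof.
move=> x0 x1; rewrite -div1r ler_pdivlMr ?subr_gt0// mulrC.
have := subrX1 x n; have := exprn_ge0 n x0; lra.
Qed.

Lemma exists_pow2_gt x : exists n, x < 2 ^+ n.
Proof. by exists (Num.bound x); exact: upper_nthrootP. Qed.

Lemma dyadic_scale h x n : x < h -> h / 2 ^+ n <= x ->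
  exists2 m, (m < n)%N & h / 2 ^+ m.+1 <= x < h / 2 ^+ m.
Proof.
move=> xh; elim: n => [|n ih]; first by rewrite expr0 divr1 leNgt xh.
move=> hn; have [/ih[m mn H]|h'] := leP (h / 2 ^+ n) x.
  by exists m => //; exact: ltnW.
by exists n => //; rewrite hn.
Qed.

Lemma mulr_pow2_powR h a m : 0 <= h ->
  (h / 2 ^+ m) `^ a = h `^ a * (2^-1 `^ a) ^+ m.
Proof.
by move=> h0; rewrite powRM ?invr_ge0 ?exprn_ge0// -exprVn powR_exp// invr_ge0.
Qed.

End real_scales.

Section weighted_measure.
Variables (R : realType) (N : nat).
Local Notation CN := (N.-tuple R[i]).
Local Notation B := (@cball R N).
Local Notation mu := (ball_measure R N).

Lemma ball_weightE q (z : CN) : ball_weight q z = delta z `^ q.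
Proof. by []. Qed.

Lemma ball_weight_ge0 q (z : CN) : 0 <= ball_weight q z.
Proof. exact: powR_ge0. Qed.

Lemma measurable_ball_weight q d (T : measurableType d) (F : T -> CN) :
  measurable_fun setT F -> measurable_fun setT (fun x => ball_weight q (F x)).
Proof.
move=> mF; apply: (measurableT_comp (measurable_powR _)); exact: measurable_delta.
Qed.

Lemma measurable_ball_weightE q (D : set CN) :
  measurable_fun D (fun w => (ball_weight q w)%:E).
Proof.
by apply/measurable_EFinP; apply: measurable_funTS; exact: measurable_ball_weight.
Qed.

Definition inv_vol : R := (fine (lebesgue_Cn R N B))^-1.

Lemma inv_vol_gt0 : 0 < inv_vol.
Proof.
rewrite /inv_vol invr_gt0 -lte_fin fineK ?lebesgue_cball_gt0//.
by rewrite ge0_fin_numE ?measure_ge0 ?lebesgue_cball_lty.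
Qed.

Lemma ball_measureE (S : set CN) : mu S = (inv_vol%:E * lebesgue_Cn R N S)%E.
Proof. by []. Qed.

End weighted_measure.

Section weighted_shell.
Variables (R : realType) (n : nat).
Local Notation CN := (n.+1.-tuple R[i]).
Local Notation B := (@cball R n.+1).
Local Notation mu := (ball_measure R n.+1).

(** Dyadic layers in the height: where delta is about h / 2^i, the weight is about (h / 2^i)^s and
    the volume at most C r^(n+1) h / 2^i. The layers sum like a geometric series of ratio [t], here
    2^(-(1 + s)), below 1 because s > -1. The cut-off [e] makes the layers finite in number and does
    not enter the constant. *)
Lemma weighted_shell (s : R) : -1 < s -> exists2 C : R, 0 < C &
  forall z (r h e : R), B z -> 0 < r -> 0 < h -> 0 < e ->
  (mu_ s (shell z r h `&` [set w | (e <= delta w)%R]) <=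
   (C * r ^+ n.+1 * h `^ (1 + s))%:E)%E.
Proof.
move=> s1; have [C C0 HC] := shell_volume R n.
have v0 := inv_vol_gt0 R n.+1; set v := inv_vol R n.+1 in v0.
have s10 : 0 < 1 + s by lra.
pose t : R := 2^-1 `^ (1 + s).
have t0 : 0 <= t by exact: powR_ge0.
have t1 : t < 1 by exact: half_powR_lt1.
pose K : R := 2 `^ `|s|.
have K0 : 0 < K by exact: powR_gt0.
exists (K * v * C / (1 - t)); first by rewrite divr_gt0 ?subr_gt0// !mulr_gt0.
move=> z r h e Bz r0 h0 e0.
have [m hm] := exists_pow2_gt (h / e).
have {}hm : h / 2 ^+ m <= e.
  by rewrite ler_pdivrMr ?exprn_gt0// -ler_pdivrMl// mulrC ltW.
pose x (i : nat) : R := h / 2 ^+ i.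
have x0 i : 0 < x i by rewrite divr_gt0// exprn_gt0.
set S := shell z r h `&` _.
have mS : measurable S.
  by apply: measurableI; [exact: measurable_shell|exact/measurable_ler_set/measurable_delta].
pose g (i : 'I_m) (w : CN) : \bar R := (K * x i `^ s * \1_(shell z r (x i)) w)%:E.
have mg i D : measurable_fun D (g i).
  apply/measurable_EFinP; apply: measurable_funM => //.
  by apply: measurable_funTS; apply: measurable_indic; exact: measurable_shell.
have g0 i w : (0 <= g i w)%E.
  by rewrite lee_fin !mulr_ge0 ?powR_ge0// ltW.
have mSB : measurable (S `&` B) by apply: measurableI => //; exact: measurable_cball.
apply: (@le_trans _ _ (\int[mu]_(w in S `&` B) (\sum_(i < m) g i w))%E).
  apply: ge0_le_integral => //.
  - by move=> w _; rewrite lee_fin ball_weight_ge0.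
  - exact: measurable_ball_weightE.
  - by apply: emeasurable_sum => i.
  move=> w [[[[Bw rw] wh] ew] _].
  have [i im /andP[xi1 xi2]] := dyadic_scale wh (le_trans hm ew).
  rewrite (bigD1 (Ordinal im))//=.
  apply: (@le_trans _ _ (g (Ordinal im) w)); last first.
    by rewrite leeDl// sume_ge0.
  rewrite lee_fin indicE mem_set ?mulr1; last by [].
  rewrite ball_weightE; apply: powR_le_comparable => //.
  - by rewrite ler1n.
  - exact/delta_gt0.
  - move: xi1; rewrite exprS invfM mulrCA -/(x i) => xi1.
    by rewrite -ler_pdivrMl.
  - by rewrite (le_trans (ltW xi2))// -/(x i) ler_peMl ?ler1n// ltW.
rewrite ge0_integral_sum//.
apply: (@le_trans _ _ (\sum_(i < m) (K * v * C * r ^+ n.+1 * h `^ (1 + s) * t ^+ i)%:E)%E).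
  apply: lee_sum => i _.
  apply: (@le_trans _ _ (\int[mu]_w g i w)%E).
    by apply: ge0_subset_integral.
  rewrite /g; under eq_integral do rewrite EFinM.
  rewrite ge0_integralZl//; last 2 first.
  - by apply/measurable_EFinP; apply: measurable_indic; exact: measurable_shell.
  - by rewrite lee_fin mulr_ge0 ?powR_ge0// ltW.
  rewrite integral_indic ?setIT; [|exact: measurableT|exact: measurable_shell].
  rewrite ball_measureE -/v.
  have H := HC z r (x i) Bz r0 (x0 i).
  apply: (@le_trans _ _ ((K * x i `^ s)%:E * (v%:E * (C * r ^+ n.+1 * x i)%:E))%E).
    rewrite lee_pmul2l// ?lte_fin ?mulr_gt0 ?powR_gt0//.
    by rewrite lee_pmul2l// ?lte_fin.
  rewrite -!EFinM lee_fin le_eqVlt; apply/orP; left; apply/eqP.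
  rewrite -(mulrA _ (h `^ (1 + s))).
  have -> : h `^ (1 + s) * t ^+ i = x i `^ s * x i.
    rewrite /t -mulr_pow2_powR ?ltW// -/(x i) powRD; last by rewrite gt_eqF ?implybT.
    by rewrite powRr1 ?ltW// mulrC.
  ring.
rewrite sumEFin lee_fin -mulr_sumr.
have := geometric_sum_le m t0 t1 => H.
rewrite [leRHS](_ : _ = K * v * C * r ^+ n.+1 * h `^ (1 + s) * (1 - t)^-1); last by ring.
rewrite ler_wpM2l// !mulr_ge0 ?powR_ge0 ?exprn_ge0// ltW//.
Qed.

End weighted_shell.

(** * The kernel and the measurability of the operator *)

Section principal_power.
Variable R : realType.
Implicit Types x : R[i].

Lemma normc_cexp x : normc (cexp x) = expR (complex.Re x).
Proof.
rewrite /cexp /= !exprMn -mulrDr cos2Dsin2 mulr1 sqrtr_sqr ger0_norm ?expR_ge0//.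
Qed.

Lemma cpowE x a : cpow x a =
  (expR (a * ln (normc x)) * cos (a * carg x)) +i*
  (expR (a * ln (normc x)) * sin (a * carg x)).
Proof. by rewrite /cpow /cexp /clog /= !mul0r subr0 addr0. Qed.

Lemma normc_cpow x a : 0 < normc x -> normc (cpow x a) = normc x `^ a.
Proof.
move=> x0; rewrite /cpow normc_cexp /clog /= mul0r subr0.
by rewrite /powR gt_eqF.
Qed.

Lemma Re_cpow x a : 0 < normc x ->
  complex.Re (cpow x a) = normc x `^ a * cos (a * carg x).
Proof. by move=> x0; rewrite cpowE /= /powR gt_eqF. Qed.

Lemma Im_cpow x a : 0 < normc x ->
  complex.Im (cpow x a) = normc x `^ a * sin (a * carg x).
Proof. by move=> x0; rewrite cpowE /= /powR gt_eqF. Qed.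

(** For u >= 0 one has acos (1 / sqrt (1 + u^2)) = atan u, used with u = |Im x| / Re x; the case
    distinction in [carg] is the oddness of [atan]. This form gives both the measurability of the
    argument and its smallness when Im x / Re x is small. *)
Lemma carg_atan x : 0 < complex.Re x ->
  carg x = atan (complex.Im x / complex.Re x).
Proof.
case: x => a b /= a0.
have key (u : R) : 0 <= u -> acos (a / Num.sqrt (a ^+ 2 + (a * u) ^+ 2)) = atan u.
  move=> u0; rewrite -[RHS]cosK; last first.
    rewrite in_itv /=; apply/andP; split.
      by rewrite -[leLHS](@atan0 R) le_atan.
    by rewrite (le_trans (ltW (atan_ltpi2 _)))// ler_pdivrMr// ler_peMr ?pi_ge0// ler1n.
  congr acos; rewrite cos_atan.
  have -> : a ^+ 2 + (a * u) ^+ 2 = a ^+ 2 * (1 + u ^+ 2) by ring.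
  rewrite sqrtrM ?sqr_ge0// sqrtr_sqr gtr0_norm//.
  by rewrite invfM mulrA mulfV ?mul1r// gt_eqF.
have ba : b = a * (b / a) by rewrite mulrC divfK// gt_eqF.
rewrite /carg /=; case: ifPn => b0.
  by rewrite {1}ba key// divr_ge0// ltW.
rewrite -ltNge in b0.
rewrite -[X in Num.sqrt (_ + X)]sqrrN {1}ba -mulrN key; last first.
  by rewrite oppr_ge0 ltW// pmulr_llt0 ?invr_gt0.
by rewrite atanN opprK.
Qed.

End principal_power.

Section kernel.
Variables (R : realType) (N : nat).
Local Notation CN := (N.-tuple R[i]).
Local Notation B := (@cball R N).
Implicit Types z w : CN.

Lemma Re_gt0_1Bcdot z w : B z -> B w -> 0 < complex.Re (1 - cdot z w).
Proof.
move=> /delta_gt0 + /delta_gt0; rewrite /delta => z1 w1.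
have := cdot_le z w; have := normr_Re_le (cdot z w).
have := ler_norm (complex.Re (cdot z w)); rewrite cReD cReN /=; lra.
Qed.

(* the argument of 1 - <z, w>; powR _ (-1) rather than an inverse, because powR comes with
   a measurability lemma *)
Definition kernel_arg z w : R :=
  atan (complex.Im (1 - cdot z w) * complex.Re (1 - cdot z w) `^ (-1)).

Lemma normc_kernel (a : R) z w : B z -> B w ->
  normc (bergman_kernel a z w) = rho z w `^ (- (N%:R + 1 + a)).
Proof. by move=> Bz Bw; rewrite /bergman_kernel normc_cpow// -/(rho z w) rho_gt0. Qed.

Lemma carg_kernel z w : B z -> B w -> carg (1 - cdot z w) = kernel_arg z w.
Proof.
move=> Bz Bw; have h := Re_gt0_1Bcdot Bz Bw.
by rewrite carg_atan// /kernel_arg powR_inv1 ?ltW.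
Qed.

Lemma Re_kernel (a : R) z w : B z -> B w -> complex.Re (bergman_kernel a z w) =
  rho z w `^ (- (N%:R + 1 + a)) * cos (- (N%:R + 1 + a) * kernel_arg z w).
Proof.
by move=> Bz Bw; rewrite /bergman_kernel Re_cpow ?carg_kernel// -/(rho z w) rho_gt0.
Qed.

Lemma Im_kernel (a : R) z w : B z -> B w -> complex.Im (bergman_kernel a z w) =
  rho z w `^ (- (N%:R + 1 + a)) * sin (- (N%:R + 1 + a) * kernel_arg z w).
Proof.
by move=> Bz Bw; rewrite /bergman_kernel Im_cpow ?carg_kernel// -/(rho z w) rho_gt0.
Qed.

Lemma measurable_kernel_arg d (T : measurableType d) (F G : T -> CN) :
  measurable_fun setT F -> measurable_fun setT G ->
  measurable_fun setT (fun x => kernel_arg (F x) (G x)).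
Proof.
move=> mF mG; apply: (measurableT_comp (f := @atan R)).
  by apply: continuous_measurable_fun => x; exact: continuous_atan.
apply: measurable_funM.
  rewrite (_ : (fun x => _) = fun x =>
      complex.Im (1 : R[i]) - complex.Im (cdot (F x) (G x))); last first.
    by apply/funext => x; rewrite -cImN -cImD.
  by apply: measurable_funB => //; exact: measurable_Im_cdot.
apply: (measurableT_comp (measurable_powR _)).
rewrite (_ : (fun x => _) = fun x =>
    complex.Re (1 : R[i]) - complex.Re (cdot (F x) (G x))); last first.
  by apply/funext => x; rewrite -cReN -cReD.
by apply: measurable_funB => //; exact: measurable_Re_cdot.
Qed.

Lemma measurable_rho_powR (a : R) d (T : measurableType d) (F G : T -> CN) :
  measurable_fun setT F -> measurable_fun setT G ->
  measurable_fun setT (fun x => rho (F x) (G x) `^ a).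
Proof.
by move=> mF mG; apply: (measurableT_comp (measurable_powR _)); exact: measurable_rho.
Qed.

Lemma measurable_cos_kernel_arg (a : R) d (T : measurableType d) (F G : T -> CN) :
  measurable_fun setT F -> measurable_fun setT G ->
  measurable_fun setT (fun x => cos (a * kernel_arg (F x) (G x))).
Proof.
move=> mF mG; apply: (measurableT_comp (f := @cos R)).
  by apply: continuous_measurable_fun; exact: continuous_cos.
by apply: measurable_funM => //; exact: measurable_kernel_arg.
Qed.

Lemma measurable_sin_kernel_arg (a : R) d (T : measurableType d) (F G : T -> CN) :
  measurable_fun setT F -> measurable_fun setT G ->
  measurable_fun setT (fun x => sin (a * kernel_arg (F x) (G x))).
Proof.
move=> mF mG; apply: (measurableT_comp (f := @sin R)).
  by apply: continuous_measurable_fun; exact: continuous_sin.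
by apply: measurable_funM => //; exact: measurable_kernel_arg.
Qed.

End kernel.

(** * The operator in real form: measurability and a pointwise bound *)

Section parametric_integral.
Variables (R : realType) (N : nat).
Local Notation CN := (N.-tuple R[i]).
Local Notation mu := (ball_measure R N).

(** Tonelli is applied to [lebesgue_Cn], which carries its sigma-finite structure, after the
    constant [inv_vol] has been pulled out. *)
Lemma measurable_ge0_parametric_integral (g : CN * CN -> \bar R) :
  measurable_fun setT g -> (forall x, (0 <= g x)%E) ->
  measurable_fun setT (fun z => \int[mu]_w g (z, w))%E.
Proof.
move=> mg g0.
rewrite (_ : (fun z => _) = fun z =>
    ((inv_vol R N)%:E * \int[lebesgue_Cn R N]_w g (z, w))%E); last first.
  apply/funext => z; apply: ge0_integral_mscale => //.
  exact: measurable_fun_pair2.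
apply: measurable_funeM.
exact: (@measurable_fun_fubini_tonelli_F _ _ _ _ _ (lebesgue_Cn R N)).
Qed.

(** No integrability is assumed: where the integral is infinite, [fine] takes its default value 0,
    and the composite is still measurable in [z]. *)
Lemma measurable_parametric_Rintegral (g : CN * CN -> R) :
  measurable_fun setT g ->
  measurable_fun setT (fun z => \int[mu]_w g (z, w)).
Proof.
move=> mg; apply: (measurableT_comp (f := fine)); first exact: fine_measurable.
under eq_fun do rewrite integralE.
have mg' : measurable_fun setT (EFin \o g) by exact/measurable_EFinP.
apply: emeasurable_funB.
- rewrite (_ : (fun z => _) = fun z => (\int[mu]_w ((EFin \o g)^\+)%E (z, w))%E).
    apply: measurable_ge0_parametric_integral; first exact: measurable_funepos.
    by move=> x; exact: funepos_ge0.
  by apply/funext => z; apply: eq_integral => w _; rewrite !funeposE.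
- rewrite (_ : (fun z => _) = fun z => (\int[mu]_w ((EFin \o g)^\-)%E (z, w))%E).
    apply: measurable_ge0_parametric_integral; first exact: measurable_funeneg.
    by move=> x; exact: funeneg_ge0.
  by apply/funext => z; apply: eq_integral => w _; rewrite !funenegE.
Qed.

End parametric_integral.

Section bergman_operator.
Variables (R : realType) (N : nat).
Local Notation CN := (N.-tuple R[i]).
Local Notation B := (@cball R N).
Local Notation mu := (ball_measure R N).
Variables (s t : R) (f : CN -> R[i]).
Hypothesis mf : measurable_fun B f.

Let a : R := - (N%:R + 1 + (s + t)).
Let mB : measurable B. Proof. exact: measurable_cball. Qed.

(** Extension by zero off the ball makes the integrand jointly measurable on the whole product space
    and turns integrals over the ball into integrals over the space. *)
Let fre : CN -> R := (@complex.Re R \o f) \_ B.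
Let fim : CN -> R := (@complex.Im R \o f) \_ B.

Let mfre : measurable_fun setT fre.
Proof.
apply: (iffLR (measurable_restrictT _ mB)).
exact: (measurableT_comp (@measurable_Re R) mf).
Qed.

Let mfim : measurable_fun setT fim.
Proof.
apply: (iffLR (measurable_restrictT _ mB)).
exact: (measurableT_comp (@measurable_Im R) mf).
Qed.

(** The kernel in polar form. Agreement with the true integrand is claimed only for [z] and [w] in
    the ball, whereas [rho] and [kernel_arg] make this expression measurable everywhere. *)
Definition integrand_Re (z w : CN) : R := rho z w `^ a *
  (cos (a * kernel_arg z w) * fre w - sin (a * kernel_arg z w) * fim w) *
  ball_weight s w.

Definition integrand_Im (z w : CN) : R := rho z w `^ a *
  (cos (a * kernel_arg z w) * fim w + sin (a * kernel_arg z w) * fre w) *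
  ball_weight s w.

Let mf2 (h : CN -> R) : measurable_fun setT h ->
  measurable_fun setT (fun x : CN * CN => h x.2).
Proof. by move=> mh; exact: (measurableT_comp mh). Qed.

Lemma measurable_integrand_Re :
  measurable_fun setT (fun x : CN * CN => integrand_Re x.1 x.2).
Proof.
apply: measurable_funM; last exact: (measurable_ball_weight s measurable_snd).
apply: measurable_funM.
  exact: (measurable_rho_powR a measurable_fst measurable_snd).
apply: measurable_funB; apply: measurable_funM.
- exact: (measurable_cos_kernel_arg a measurable_fst measurable_snd).
- exact: mf2.
- exact: (measurable_sin_kernel_arg a measurable_fst measurable_snd).
- exact: mf2.
Qed.

Lemma measurable_integrand_Im :
  measurable_fun setT (fun x : CN * CN => integrand_Im x.1 x.2).
Proof.
apply: measurable_funM; last exact: (measurable_ball_weight s measurable_snd).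
apply: measurable_funM.
  exact: (measurable_rho_powR a measurable_fst measurable_snd).
apply: measurable_funD; apply: measurable_funM.
- exact: (measurable_cos_kernel_arg a measurable_fst measurable_snd).
- exact: mf2.
- exact: (measurable_sin_kernel_arg a measurable_fst measurable_snd).
- exact: mf2.
Qed.

Let integrand z w := bergman_kernel (s + t) z w * f w * (ball_weight s w)%:C.

Lemma Re_integrandE z w : B z -> B w ->
  complex.Re (integrand z w) = integrand_Re z w.
Proof.
move=> Bz Bw; rewrite /integrand /integrand_Re /fre /fim !patchE mem_set//=.
rewrite -[LHS]/(complex.Re (bergman_kernel (s + t) z w * f w * (ball_weight s w)%:C)).
rewrite cReM (cReM (bergman_kernel _ _ _)) Re_kernel// Im_kernel// -/a /=.
by rewrite mulr0 subr0 mulrBr !mulrA.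
Qed.

Lemma Im_integrandE z w : B z -> B w ->
  complex.Im (integrand z w) = integrand_Im z w.
Proof.
move=> Bz Bw; rewrite /integrand /integrand_Im /fre /fim !patchE mem_set//=.
rewrite -[LHS]/(complex.Im (bergman_kernel (s + t) z w * f w * (ball_weight s w)%:C)).
rewrite cImM (cImM (bergman_kernel _ _ _)) Re_kernel// Im_kernel// -/a /=.
by rewrite mulr0 add0r mulrDr !mulrA.
Qed.

Let integrand_Re_out z w : ~ B w -> integrand_Re z w = 0.
Proof.
by move=> Bw; rewrite /integrand_Re /fre /fim !patchE memNset// !mulr0 subr0 mulr0 mul0r.
Qed.

Let integrand_Im_out z w : ~ B w -> integrand_Im z w = 0.
Proof.
by move=> Bw; rewrite /integrand_Im /fre /fim !patchE memNset// !mulr0 addr0 mulr0 mul0r.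
Qed.

Lemma Re_cintegralE z : B z ->
  complex.Re (cintegral (integrand z)) = \int[mu]_w integrand_Re z w.
Proof.
move=> Bz; rewrite /cintegral /= /Rintegral integral_mkcond; congr fine.
apply: eq_integral => w _; rewrite patchE; case: ifPn => [/set_mem Bw|/negP Bw].
  by rewrite Re_integrandE.
by rewrite integrand_Re_out// => Bw'; apply: Bw; exact: mem_set.
Qed.

Lemma Im_cintegralE z : B z ->
  complex.Im (cintegral (integrand z)) = \int[mu]_w integrand_Im z w.
Proof.
move=> Bz; rewrite /cintegral /= /Rintegral integral_mkcond; congr fine.
apply: eq_integral => w _; rewrite patchE; case: ifPn => [/set_mem Bw|/negP Bw].
  by rewrite Im_integrandE.
by rewrite integrand_Im_out// => Bw'; apply: Bw; exact: mem_set.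
Qed.

Lemma bergman_opE z : B z -> bergman_op s t f z =
  (ball_weight t z * \int[mu]_w integrand_Re z w) +i*
  (ball_weight t z * \int[mu]_w integrand_Im z w).
Proof.
move=> Bz; rewrite -Re_cintegralE// -Im_cintegralE// /bergman_op -/(integrand z).
by case: (cintegral _) => x y /=; apply/eqP; rewrite eq_complex /= !mul0r subr0 addr0 !eqxx.
Qed.

Lemma measurable_bergman_op : measurable_fun B (bergman_op s t f).
Proof.
have mw : measurable_fun setT (@ball_weight R N t) by exact: measurable_ball_weight.
have mR : measurable_fun setT (fun z => ball_weight t z * \int[mu]_w integrand_Re z w).
  apply: measurable_funM => //.
  exact: (measurable_parametric_Rintegral measurable_integrand_Re).
have mI : measurable_fun setT (fun z => ball_weight t z * \int[mu]_w integrand_Im z w).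
  apply: measurable_funM => //.
  exact: (measurable_parametric_Rintegral measurable_integrand_Im).
have mp := measurableT_comp (@measurable_prod_to_complex R) (measurable_fun_pair mR mI).
apply: (eq_measurable_fun _ _ (measurable_funTS mp)) => z /set_mem Bz.
by rewrite bergman_opE.
Qed.

Let EFin_normr_Rintegral_le (g : CN -> R) : measurable_fun B g ->
  ((`|\int[mu]_(w in B) g w|)%:E <= \int[mu]_(w in B) (`|g w|)%:E)%E.
Proof.
move=> mg; apply: (@le_trans _ _ (`|\int[mu]_(w in B) (g w)%:E|)%E).
  (* For an infinite integral the left-hand side is 0 by default and the right-hand side is +oo. *)
  by rewrite /Rintegral; case: (integral _ _ _) => [r| |]//=; rewrite ?leey// normr0.
by apply: le_abse_integral => //; exact/measurable_EFinP.
Qed.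

(** Only the modulus of the kernel is kept; the factor 2 comes from |x| <= |Re x| + |Im x|. The
    right-hand side is allowed to be infinite. *)
Lemma bergman_op_le z : B z ->
  ((normc (bergman_op s t f z))%:E <= (2 * delta z `^ t)%:E *
   \int[mu]_(w in B) (rho z w `^ a * (normc (f w) * ball_weight s w))%:E)%E.
Proof.
move=> Bz.
rewrite /bergman_op ComplexField.Normc.normcM normc_real ger0_norm ?ball_weight_ge0//.
rewrite ball_weightE EFinM mulrC EFinM -muleA.
rewrite lee_pmul2l ?lte_fin ?powR_gt0//; last exact/delta_gt0.
set I := (\int[mu]_(w in B) _)%E.
have mRe : measurable_fun B (fun w => complex.Re (integrand z w)).
  have h := measurable_funTS (D := B) (measurable_fun_pair2 z measurable_integrand_Re).
  by apply: (eq_measurable_fun _ _ h) => w /set_mem Bw; rewrite Re_integrandE.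
have mIm : measurable_fun B (fun w => complex.Im (integrand z w)).
  have h := measurable_funTS (D := B) (measurable_fun_pair2 z measurable_integrand_Im).
  by apply: (eq_measurable_fun _ _ h) => w /set_mem Bw; rewrite Im_integrandE.
have mI : measurable_fun B (fun w => rho z w `^ a * (normc (f w) * ball_weight s w)).
  apply: measurable_funM; first by apply: measurable_funTS; exact: measurable_rho_powR.
  apply: measurable_funM; last by apply: measurable_funTS; exact: measurable_ball_weight.
  by apply: measurable_normc;
    [exact: (measurableT_comp (@measurable_Re R) mf)
    |exact: (measurableT_comp (@measurable_Im R) mf)].
have le w : B w -> normc (integrand z w) = rho z w `^ a * (normc (f w) * ball_weight s w).
  move=> Bw; rewrite /integrand !ComplexField.Normc.normcM normc_kernel// -/a normc_real.
  by rewrite ger0_norm ?ball_weight_ge0// mulrA.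
have leRe : ((`|complex.Re (cintegral (integrand z))|)%:E <= I)%E.
  apply: (le_trans (EFin_normr_Rintegral_le mRe)); apply: ge0_le_integral => //.
  - by apply/measurable_EFinP; apply: measurableT_comp.
  - exact/measurable_EFinP.
  - by move=> w Bw; rewrite lee_fin -le//; exact: normr_Re_le.
have leIm : ((`|complex.Im (cintegral (integrand z))|)%:E <= I)%E.
  apply: (le_trans (EFin_normr_Rintegral_le mIm)); apply: ge0_le_integral => //.
  - by apply/measurable_EFinP; apply: measurableT_comp.
  - exact/measurable_EFinP.
  - by move=> w Bw; rewrite lee_fin -le//; exact: normr_Im_le.
apply: (@le_trans _ _ (`|complex.Re (cintegral (integrand z))| +
    `|complex.Im (cintegral (integrand z))|)%:E).
  by rewrite lee_fin normc_le_ReIm.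
rewrite EFinD (le_trans (leeD leRe leIm))//.
by rewrite mule_natl mule2n.
Qed.

End bergman_operator.

(** * Weak type *)

Section density.
Context d (T : measurableType d) (R : realType).
Variables (m : {measure set T -> \bar R}) (D : set T) (g : T -> \bar R).
Hypotheses (mD : measurable D) (mg : measurable_fun D g)
  (g0 : forall x, D x -> (0 <= g x)%E).

(** The side conditions are arguments so that the measure structure declared below can be read off
    the term. It serves both for [mu_ s] and for the mass |f| mu_s. *)
Definition density_of of measurable D & measurable_fun D g &
  (forall x, D x -> (0 <= g x)%E) := fun A : set T => (\int[m]_(x in A `&` D) g x)%E.

Local Notation nu := (density_of mD mg g0).

Let nu0 : nu set0 = 0%E.
Proof. by rewrite /density_of set0I integral_set0. Qed.

Let nu_ge0 A : (0 <= nu A)%E.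
Proof. by apply: integral_ge0 => x [_ /g0]. Qed.

Let nu_sigma_additive : semi_sigma_additive nu.
Proof.
rewrite (_ : nu = fun A => \int[m]_(x in A) (g \_ D) x)%E; last first.
  by apply/funext => A; exact: integral_mkcondr.
apply: semi_sigma_additive_nng_induced.
  exact: (iffLR (measurable_restrictT _ mD)).
by move=> x; rewrite patchE; case: ifPn => // /set_mem /g0.
Qed.

HB.instance Definition _ := isMeasure.Build _ _ _ nu nu0 nu_ge0 nu_sigma_additive.

End density.

(** * Greedy selection and the cover of one level *)

Section disjoint_families.
Context (U : choiceType) (T : Type).
Variable D : U -> set T.

Fixpoint pairwise_disjoint (r : seq U) : Prop :=
  if r is i :: r' then
    (forall j, j \in r' -> D i `&` D j = set0) /\ pairwise_disjoint r'
  else True.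

(* greedy selection: each new element has radius at least half of the supremum
   over those whose set is disjoint from all the sets selected so far *)
Lemma greedy_cover (R : realType) (E : set U) (r : U -> R) (M : R) (k : nat) :
  (forall z, E z -> 0 < r z <= M) ->
  (forall s : seq U, (forall i, i \in s -> E i) -> pairwise_disjoint s -> (size s <= k)%N) ->
  exists s : seq U, [/\ forall i, i \in s -> E i, pairwise_disjoint s &
    forall z, E z -> exists i, [/\ i \in s, r z <= 2 * r i & D z `&` D i !=set0]].
Proof.
move=> rM hk.
pose covered (s : seq U) z := exists i, [/\ i \in s, r z <= 2 * r i & D z `&` D i !=set0].
pose free (s : seq U) z := E z /\ forall i, i \in s -> D z `&` D i = set0.
(* After [l] steps either [l] elements have been selected or everything is covered; at [l = k.+1]
   the first alternative contradicts the bound [k] on disjoint selections. *)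
suff : forall l, exists s : seq U, [/\ forall i, i \in s -> E i, pairwise_disjoint s,
    forall z, E z -> covered s z \/ free s z &
    (size s = l) \/ (forall z, E z -> covered s z)].
  move=> /(_ k.+1)[s [sE sd _ [sk|sc]]]; last by exists s; split.
  by have := hk _ sE sd; rewrite sk ltnn.
elim=> [|l [s [sE sd sf [sl|sc]]]]; last by exists s; split => //; right.
  by exists [::]; split => //; [move=> z Ez; right; split|left].
have [[z1 fz1]|/forallNP nf] := pselect (exists z, free s z); last first.
  exists s; split => //; right => z Ez.
  by have [//|/nf] := sf _ Ez.
pose A : set R := r @` free s.
have supA : has_sup A.
  split; first by exists (r z1), z1.
  by exists M => _ [z [/rM /andP[_ ?] _] <-].
have [_ [z [Ez dz] <-] hz] : exists2 x, A x & sup A / 2 < x.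
  apply: sup_gt; first by case: supA.
  have : r z1 <= sup A by apply: sup_upper_bound => //; exists z1.
  have /andP[+ _] := rM _ fz1.1. lra.
exists (z :: s); split.
- by move=> i; rewrite inE => /orP[/eqP->//|/sE].
- by split.
- move=> y Ey; have [[i [si ri Di]]|[_ fy]] := sf _ Ey.
    by left; exists i; split => //; rewrite inE si orbT.
  have [yz|yz] := pselect (D y `&` D z = set0).
    by right; split=> // i; rewrite inE => /orP[/eqP->//|/fy].
  left; exists z; split; first by rewrite mem_head.
    have : r y <= sup A by apply: sup_upper_bound => //; exists y.
    lra.
  exact/set0P/eqP.
- by left; rewrite /= sl.
Qed.

End disjoint_families.

Lemma measure_sum_disjoint_le d (T : measurableType d) (R : realType)
    (m : {measure set T -> \bar R}) (U : choiceType) (D : U -> set T) (s : seq U)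
    (A : set T) : measurable A -> (forall i, measurable (D i)) ->
  (forall i, i \in s -> D i `<=` A) -> pairwise_disjoint D s ->
  (\sum_(i <- s) m (D i) <= m A)%E.
Proof.
move=> mA mD; elim: s A mA => [|i s IH] A mA DA /=.
  by rewrite big_nil.
move=> [di ds]; rewrite big_cons.
have -> : A = D i `|` (A `\` D i) by rewrite setDUK//; apply: DA; rewrite mem_head.
rewrite measureU//; [|exact: measurableD|by rewrite setDIK].
apply: leeD => //; apply: IH => //; first exact: measurableD.
move=> j js x Dx; split; first by apply: (DA j) => //; rewrite inE js orbT.
by move=> Dix; have : (D i `&` D j) x by []; rewrite di.
Qed.

Section level_sets.
Variables (R : realType) (n : nat) (s : R).
Hypothesis s1 : -1 < s.
Local Notation CN := (n.+1.-tuple R[i]).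
Local Notation B := (@cball R n.+1).
Local Notation mu := (ball_measure R n.+1).
Local Notation theta := (2^-1 `^ (1 + s)).

Lemma weight_nonneg (x : CN) : B x -> (0 <= (ball_weight s x)%:E)%E.
Proof. by move=> _; rewrite lee_fin ball_weight_ge0. Qed.

Lemma mu_E : @mu_ R n.+1 s = density_of mu (@measurable_cball R n.+1)
  (measurable_ball_weightE s (D := B)) weight_nonneg.
Proof. by []. Qed.

(** The quantity charged to [F] is the measure r^d of a full quasi-ball of radius r = 2^l delta(z),
    whereas the bad points near it lie at height about 2^(-l) r. The ratio of the two measures is
    [theta ^+ l] up to a constant, and disjointness of the selected quasi-balls bounds the total
    charge by [F B]. *)
Lemma level_cover : exists2 C : R, 0 < C &
  forall (F : {measure set CN -> \bar R}) (l : nat) (k e : R),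
    (F B < +oo)%E -> 0 < k -> 0 < e ->
  exists G : set CN, [/\ measurable G,
    (mu_ s G <= (C * theta ^+ l / k)%:E * F B)%E &
    forall z, B z -> e <= delta z ->
    ((k * ((2 ^+ l * delta z) ^+ n.+1 * (2 ^+ l * delta z) `^ (1 + s)))%:E <
      F (qball z (2 ^+ l * delta z)))%E -> G z].
Proof.
have s10 : 0 <= 1 + s by rewrite -lerBlDl sub0r ltW.
have [C0 C00 HC] := weighted_shell n s1.
exists (C0 * 12 ^+ n.+1 * 4 `^ (1 + s)).
  by rewrite !mulr_gt0 ?powR_gt0 ?exprn_gt0.
move=> F l k e Foo k0 e0.
pose rad (z : CN) := 2 ^+ l * delta z.
pose vol (r : R) := r ^+ n.+1 * r `^ (1 + s).
have vol_ge (x y : R) : 0 <= x -> x <= y -> vol x <= vol y.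
  move=> x0 xy; have y0 : 0 <= y by exact: le_trans xy.
  apply: ler_pM; rewrite ?exprn_ge0 ?powR_ge0//.
    by rewrite ler_pXn2r.
  by apply: ge0_ler_powR; rewrite ?nnegrE.
have vol_gt0 (x : R) : 0 < x -> 0 < vol x by move=> x0; rewrite mulr_gt0 ?exprn_gt0 ?powR_gt0.
pose E : set CN := [set z | [/\ B z, e <= delta z &
  ((k * vol (rad z))%:E < F (qball z (rad z)))%E]].
have FB : F B \is a fin_num by rewrite ge0_fin_numE.
have l0 : 0 < 2 ^+ l :> R by rewrite exprn_gt0.
have radE z : E z -> 0 < rad z <= 2 ^+ l.
  move=> [/delta_gt0 dz _ _]; rewrite /rad mulr_gt0//=.
  by rewrite ler_piMr ?delta_le1// ltW.
(* A lower bound for the mass of each selected quasi-ball, as its radius is at least 2^l e;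
   disjointness then limits their number to F(B) / c. *)
pose c := k * vol (2 ^+ l * e).
have c0 : 0 < c by rewrite mulr_gt0// vol_gt0// mulr_gt0.
have mq z : measurable (qball z (rad z)) by exact: measurable_qball.
have sumF (r : seq CN) : pairwise_disjoint (fun z => qball z (rad z)) r ->
    (\sum_(i <- r) F (qball i (rad i)) <= F B)%E.
  move=> rd; apply: measure_sum_disjoint_le => //; first exact: measurable_cball.
  by move=> i _ w [].
have card (r : seq CN) : (forall i, i \in r -> E i) ->
    pairwise_disjoint (fun z => qball z (rad z)) r ->
    (size r <= Num.bound (fine (F B) / c))%N.
  move=> rE rd.
  have : (\sum_(i <- r) c%:E <= F B)%E.
    apply: (le_trans _ (sumF r rd)); rewrite big_seq [leRHS]big_seq.
    apply: lee_sum => i /rE[Bi ei Fi]; apply: le_trans (ltW Fi).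
    rewrite lee_fin /c ler_pM2l//; apply: vol_ge; first by rewrite mulr_ge0// ltW.
    by rewrite /rad ler_pM2l.
  rewrite sumEFin -(fineK FB) lee_fin big_const_seq count_predT iter_addr_0.
  rewrite -mulr_natl -ler_pdivlMr// => h; rewrite -(ler_nat R).
  apply: (le_trans h); apply: ltW; apply: archi_boundP.
  by rewrite divr_ge0 ?fine_ge0// ltW.
have [r [rE rd rc]] := greedy_cover radE card.
(* If the quasi-balls of [z] and [i] meet and [rad z <= 2 * rad i], the quasi-triangle inequality
   gives rho(i, z) < 4 (rad i + 2 rad i) = 12 rad i. Also delta z <= 2 delta i, and 4 instead of 2
   makes the inequality strict. *)
pose S (i : CN) := shell i (12 * rad i) (4 * delta i) `&` [set w | e <= delta w].
have mS i : measurable (S i).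
  by apply: measurableI; [exact: measurable_shell|exact/measurable_ler_set/measurable_delta].
exists (\bigcup_(i in [set` r]) S i); split.
- by apply: fin_bigcup_measurable => // i _; exact: mS.
- rewrite mu_E; apply: (@le_trans _ _ (\sum_(i <- r) mu_ s (S i))%E).
    rewrite mu_E; apply: measure_le_sum_cover => //.
    by apply: fin_bigcup_measurable => // i _; exact: mS.
  apply: (@le_trans _ _ (\sum_(i <- r)
      (C0 * 12 ^+ n.+1 * 4 `^ (1 + s) * theta ^+ l / k)%:E * F (qball i (rad i)))%E).
    rewrite big_seq [leRHS]big_seq; apply: lee_sum => i /rE[Bi ei Fi].
    have di : 0 < delta i by exact/delta_gt0.
    have ri : 0 < rad i by rewrite mulr_gt0.
    have := HC i (12 * rad i) (4 * delta i) e Bi.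
    move=> /(_ _ _ e0)/le_trans; apply; rewrite ?mulr_gt0//.
    rewrite (_ : _ * _ = C0 * 12 ^+ n.+1 * 4 `^ (1 + s) * theta ^+ l / k * (k * vol (rad i))).
      rewrite EFinM lee_wpmul2l ?lee_fin ?ltW// !mulr_gt0 ?invr_gt0 ?exprn_gt0 ?powR_gt0//.
    (* The height is 2^(-l) times the radius: this is the source of [theta ^+ l]. *)
    have -> : delta i = rad i / 2 ^+ l by rewrite /rad mulrAC mulfV ?mul1r// gt_eqF.
    rewrite exprMn powRM ?divr_ge0// ?ltW// mulr_pow2_powR ?ltW// /vol.
    by field; rewrite gt_eqF.
  rewrite -ge0_sume_distrr//.
  apply: lee_wpmul2l; last exact: sumF.
  by rewrite lee_fin !mulr_ge0 ?invr_ge0 ?exprn_ge0 ?powR_ge0// ltW.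
move=> z Bz ez Fz; have Ez : E z by [].
have [i [ir rzi [w [[Bw zw] [_ iw]]]]] := rc _ Ez.
have [Bi _ _] := rE _ ir; have di : 0 < delta i by exact/delta_gt0.
have dz : delta z <= 2 * delta i.
  by move: rzi; rewrite /rad mulrCA ler_pM2l.
exists i => //; split=> //; split => /=; last by lra.
split=> //; have := rho_quasi_triangle Bi Bw Bz; rewrite (rhoC w z).
by move: zw iw; rewrite -!/(rad _); lra.
Qed.

End level_sets.

Lemma dyadic_level (R : realType) (x e : R) L : e <= 2 * x -> x < 2 ^+ L * e ->
  exists2 l, (l < L.+1)%N & x < 2 ^+ l * e <= 2 * x.
Proof.
move=> ex; elim: L => [|L ih] xL.
  by exists 0%N => //; rewrite xL expr0 mul1r.
have [/ih[l lL H]|h] := ltP x (2 ^+ L * e); first by exists l => //; exact: leqW.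
by exists L.+1 => //; rewrite xL exprS -mulrA ler_pM2l.
Qed.

(** * Summation over the levels *)

Section weak_type.
Variables (R : realType) (n : nat) (s t : R).
Hypotheses (s1 : -1 < s) (st1 : -1 < s + t).
Local Notation CN := (n.+1.-tuple R[i]).
Local Notation B := (@cball R n.+1).
Local Notation mu := (ball_measure R n.+1).
Local Notation A := (n.+1%:R + 1 + (s + t)).

(** [phi] is the common ratio of the two series, and [psi] = 2^(-a) is the ratio of the thresholds.
    They satisfy [phi] = [psi] 2^(-t), used for the kernel, and [phi] [psi] = 2^(-(1 + s)), used for
    the covers. *)
Let eps : R := (1 + (s + t)) / 2.
Let phi : R := 2^-1 `^ eps.
Let psi : R := 2^-1 `^ (eps - t).
(** The 2 comes from real and imaginary parts and 2^A from comparing kernels within one dyadic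
    scale; their product with [c0] is 1 - phi, which offsets the geometric sum. *)
Let c0 : R := (1 - phi) / (2 * 2 `^ A).

Let eps_gt0 : 0 < eps.
Proof. by rewrite /eps divr_gt0// -ltrBlDl sub0r. Qed.

Let phi1 : phi < 1. Proof. exact: half_powR_lt1. Qed.
Let phi0 : 0 < phi. Proof. exact: powR_gt0. Qed.
Let psi0 : 0 < psi. Proof. exact: powR_gt0. Qed.

Let c00 : 0 < c0.
Proof. by rewrite divr_gt0 ?subr_gt0// mulr_gt0 ?powR_gt0. Qed.

Let A0 : 0 < A.
Proof. by rewrite -addrA addr_gt0// -ltrBlDl sub0r. Qed.

Section one_function.
Variable f : CN -> R[i].
Hypothesis mf : measurable_fun B f.

Let g (w : CN) : \bar R := (normc (f w) * ball_weight s w)%:E.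

Let mg : measurable_fun B g.
Proof.
apply/measurable_EFinP; apply: measurable_funM.
  by apply: measurable_normc;
    [exact: (measurableT_comp (@measurable_Re R) mf)
    |exact: (measurableT_comp (@measurable_Im R) mf)].
by apply: measurable_funTS; exact: measurable_ball_weight.
Qed.

Let g0 w : B w -> (0 <= g w)%E.
Proof. by move=> _; rewrite lee_fin mulr_ge0 ?normc_ge0 ?ball_weight_ge0. Qed.

Definition mass : {measure set CN -> \bar R} :=
  density_of mu (@measurable_cball R n.+1) mg g0.

Lemma massB : mass B = L1norm s f.
Proof. by rewrite -[LHS]/(\int[mu]_(w in B `&` B) g w)%E setIid. Qed.

(** The level selection in contrapositive form: if no quasi-ball is overloaded, summing the kernel
    over the scales gives a series of ratio [phi] with total at most [lam]. The condition on [L]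
    makes the last radius reach 2, above every value of [rho] on the ball. *)
Lemma op_le_of_small_levels (z : CN) (lam : R) (L : nat) :
  B z -> 0 < lam -> 2 <= 2 ^+ L * delta z ->
  (forall l, (l < L.+1)%N -> (mass (qball z (2 ^+ l * delta z)) <=
    (c0 * lam * psi ^+ l * ((2 ^+ l * delta z) ^+ n.+1 *
       (2 ^+ l * delta z) `^ (1 + s)))%:E)%E) ->
  normc (bergman_op s t f z) <= lam.
Proof.
move=> Bz lam0 L2 small; rewrite -lee_fin.
have dz : 0 < delta z by exact/delta_gt0.
have r0 l : 0 < 2 ^+ l * delta z by rewrite mulr_gt0// exprn_gt0.
apply: (le_trans (bergman_op_le s t mf Bz)).
pose k l : R := 2 `^ A * (2 ^+ l * delta z) `^ (- A).
have k0 l : 0 <= k l by rewrite mulr_ge0 ?powR_ge0.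
pose h (l : 'I_L.+1) (w : CN) : \bar R :=
  ((k l)%:E * (g \_ (qball z (2 ^+ l * delta z))) w)%E.
have gp0 (Q : set CN) w : B w -> (0 <= (g \_ Q) w)%E.
  by move=> Bw; rewrite patchE; case: ifPn => // _; exact: g0.
have mgp (Q : set CN) : measurable Q -> measurable_fun B (g \_ Q).
  move=> mQ; apply: (iffLR (measurable_restrict _ mQ (@measurable_cball R n.+1))).
  apply: measurable_funS mg; first exact: measurable_cball.
  exact: subIsetl.
have mh l : measurable_fun B (h l).
  by apply: measurable_funeM; apply: mgp; exact: measurable_qball.
have h0 l w : B w -> (0 <= h l w)%E.
  by move=> Bw; rewrite mule_ge0 ?lee_fin// gp0.
apply: (@le_trans _ _ ((2 * delta z `^ t)%:E *
    \int[mu]_(w in B) (\sum_(l < L.+1) h l w))%E).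
  apply: lee_wpmul2l; first by rewrite lee_fin mulr_ge0 ?powR_ge0.
  apply: ge0_le_integral => //.
  - exact: measurable_cball.
  - by move=> w Bw; rewrite lee_fin !mulr_ge0 ?powR_ge0 ?normc_ge0 ?ball_weight_ge0.
  - apply/measurable_EFinP; apply: measurable_funM.
      by apply: measurable_funTS; exact: measurable_rho_powR.
    exact/measurable_EFinP.
  - by apply: emeasurable_sum => l; exact: mh.
  move=> w Bw.
  (* At the level with rho < 2^l delta <= 2 rho the kernel is within a factor 2^A of its value at
     that radius. *)
  have [l lL /andP[rl lr]] := dyadic_level (delta_le_rho z Bw) (lt_le_trans (rho_lt2 Bz Bw) L2).
  rewrite (bigD1 (Ordinal lL))//=; apply: (@le_trans _ _ (h (Ordinal lL) w)); last first.
    by rewrite leeDl// sume_ge0// => i _; exact: h0.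
  rewrite /h patchE mem_set//= /g -EFinM lee_fin.
  rewrite ler_wpM2r ?mulr_ge0 ?normc_ge0 ?ball_weight_ge0//.
  have := @powR_le_comparable _ 2 (2 ^+ l * delta z) (rho z w) (- A).
  rewrite normrN gtr0_norm//; apply => //.
  - by rewrite ler1n.
  - exact: rho_gt0.
  - by rewrite (le_trans (ltW rl))// ler_peMl ?ler1n// ltW.
rewrite ge0_integral_sum//; last exact: measurable_cball.
apply: (@le_trans _ _ ((2 * delta z `^ t)%:E * (\sum_(l < L.+1)
   (2 `^ A * (c0 * lam) * delta z `^ (- t) * phi ^+ l)%:E))%E).
  apply: lee_wpmul2l; first by rewrite lee_fin mulr_ge0 ?powR_ge0.
  apply: lee_sum => l _; rewrite /h.
  rewrite ge0_integralZl ?lee_fin//; last 3 first.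
  - exact: measurable_cball.
  - by apply: mgp; exact: measurable_qball.
  - by move=> w Bw; exact: gp0.
  rewrite -integral_mkcondl.
  apply: (@le_trans _ _ ((k l)%:E * mass (qball z (2 ^+ l * delta z)))%E); first by [].
  apply: (le_trans (lee_wpmul2l _ (small _ (ltn_ord l)))); first by rewrite lee_fin.
  rewrite -EFinM lee_fin le_eqVlt; apply/orP; left; apply/eqP.
  rewrite /k; set r := 2 ^+ l * delta z.
  (* Since A = (n + 1) + (1 + s) + t, only r^(-t) survives. *)
  have rA : r `^ (- A) * (r ^+ n.+1 * r `^ (1 + s)) = r `^ (- t).
    have rp : 0 < r by exact: r0.
    have rD x y : r `^ x * r `^ y = r `^ (x + y).
      by rewrite powRD// (gt_eqF rp) implybT.
    by rewrite -powR_mulrn ?(ltW rp)// !rD; congr powR; ring.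
  rewrite [LHS](_ : _ = 2 `^ A * (c0 * lam * psi ^+ l) * (r `^ (- A) * (r ^+ n.+1 * r `^ (1 + s))));
    last by ring.
  rewrite rA /r powRM ?exprn_ge0// ?ltW// powR_exp//.
  have -> : phi = psi * 2 `^ (- t).
    rewrite /phi /psi (_ : 2 `^ (- t) = 2^-1 `^ t).
      rewrite -powRD ?subrK// (_ : (2^-1 == 0 :> R) = false) ?implybT//.
      by apply/negbTE; rewrite invr_eq0 pnatr_eq0.
    by rewrite powRN /powR !gt_eqF// lnV ?posrE// mulrN expRN.
  by rewrite exprMn; ring.
rewrite sumEFin -EFinM lee_fin -mulr_sumr.
have dt : delta z `^ t * delta z `^ (- t) = 1 by rewrite powRN mulfV// gt_eqF// powR_gt0.
have -> : 2 * delta z `^ t * (2 `^ A * (c0 * lam) * delta z `^ (- t) *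
    \sum_(l < L.+1) phi ^+ l) = (2 * 2 `^ A * c0) * lam *
    (delta z `^ t * delta z `^ (- t)) * \sum_(l < L.+1) phi ^+ l by ring.
have -> : 2 * 2 `^ A * c0 = 1 - phi.
  by rewrite /c0 mulrCA mulfV ?mulr1// mulf_neq0// gt_eqF// powR_gt0.
rewrite dt mulr1 mulrAC ler_piMl ?(ltW lam0)//.
rewrite -ler_pdivlMl ?subr_gt0// mulr1.
by apply: geometric_sum_le => //; exact: ltW.
Qed.

Let mTf : measurable_fun B (bergman_op s t f).
Proof. exact: measurable_bergman_op. Qed.

Lemma measurable_superlevel (lam : R) :
  measurable [set z | B z /\ lam < normc (bergman_op s t f z)].
Proof.
have mn : measurable_fun B (fun z => normc (bergman_op s t f z)).
  by apply: measurable_normc;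
    [exact: (measurableT_comp (@measurable_Re R) mTf)
    |exact: (measurableT_comp (@measurable_Im R) mTf)].
rewrite (_ : [set z | _] = B `&` (fun z => normc (bergman_op s t f z)) @^-1` `]lam, +oo[).
  by apply: mn; [exact: measurable_cball|exact: measurable_itv].
by apply/seteqP; split => z /= []; rewrite in_itv /= andbT.
Qed.

End one_function.

(** The bound for the truncated sets [Sk k] is uniform in [k], and continuity from below carries it
    over to the whole superlevel set. *)
Lemma weak_type : @bounded_L1_weakL1 R n.+1 s (@bergman_op R n.+1 s t).
Proof.
have [C1 C10 HC] := level_cover n s1.
exists (C1 / c0 / (1 - phi)); first by rewrite !divr_gt0 ?subr_gt0.
move=> f [mf foo]; split; first exact: measurable_bergman_op.
move=> lam lam0.
set S := [set z | _].
have mS : measurable S by exact: measurable_superlevel.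
pose Sk (k : nat) := S `&` [set z | (2 ^+ k)^-1 <= delta z].
have mSk k : measurable (Sk k).
  by apply: measurableI => //; exact/measurable_ler_set/measurable_delta.
have SE : S = \bigcup_k Sk k.
  apply/seteqP; split=> [z Sz|z [k _ []]//].
  have dz : 0 < delta z by case: Sz => /delta_gt0.
  have [k hk] := exists_pow2_gt (delta z)^-1.
  exists k => //; split=> //=; rewrite -(invrK (delta z)) lef_pV2 ?posrE ?exprn_gt0 ?invr_gt0//.
  exact: ltW.
have Skle k : (mu_ s (Sk k) <= (C1 / c0 / (1 - phi) / lam)%:E * L1norm s f)%E.
  pose e : R := (2 ^+ k)^-1.
  have e0 : 0 < e by rewrite invr_gt0 exprn_gt0.
  pose F := mass mf.
  have kl0 l : 0 < c0 * lam * psi ^+ l by rewrite mulr_gt0 ?exprn_gt0 ?psi0// mulr_gt0 ?c00.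
  have FB : (F B < +oo)%E by rewrite /F massB.
  have /choice[G HG] := fun l => HC F l _ _ FB (kl0 l) e0.
  apply: (@le_trans _ _ (\sum_(l < k.+2) mu_ s (G l))%E).
    rewrite mu_E; apply: measure_le_sum_cover => //.
      by move=> l; have [] := HG l.
    move=> z [[Bz Tz] ez].
    apply: contrapT => H.
    have : normc (bergman_op s t f z) <= lam.
      (* The last level is k + 1 because delta z >= 2^(-k) gives 2^(k + 1) delta z >= 2. *)
      apply: (@op_le_of_small_levels f mf z lam k.+1) => //.
        rewrite exprS -mulrA ler_peMr//.
        by rewrite -ler_pdivrMl ?exprn_gt0// mulr1.
      move=> l lk; rewrite leNgt; apply/negP => Fl; apply: H.
      exists (Ordinal lk); first by rewrite mem_index_enum.
      by have [_ _ /(_ z Bz ez Fl)] := HG l.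
    by rewrite leNgt Tz.
  apply: (@le_trans _ _ (\sum_(l < k.+2)
      (C1 / c0 / lam * phi ^+ l)%:E * L1norm s f)%E).
    apply: lee_sum => l _; have [_ + _] := HG l.
    rewrite /F massB => /le_trans; apply.
    rewrite le_eqVlt; apply/orP; left; apply/eqP; congr (_%:E * _)%E.
    have -> : 2^-1 `^ (1 + s) = phi * psi.
      rewrite /phi /psi -powRD; last first.
        by rewrite (_ : (2^-1 == 0 :> R) = false) ?implybT// invr_eq0 pnatr_eq0.
      by congr powR; rewrite /eps; field.
    by rewrite exprMn; field; rewrite !gt_eqF ?exprn_gt0.
  have L0 : (0 <= L1norm s f)%E by rewrite -(massB mf) measure_ge0.
  have Cc0 : 0 <= C1 / c0 / lam.
    by rewrite divr_ge0 ?(ltW lam0)// divr_ge0 ?(ltW C10) ?(ltW c00).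
  rewrite -ge0_sume_distrl; last first.
    by move=> l _; rewrite lee_fin mulr_ge0 ?exprn_ge0 ?(ltW phi0).
  rewrite sumEFin; apply: lee_wpmul2r => //.
  rewrite lee_fin -mulr_sumr [leRHS](_ : _ = C1 / c0 / lam * (1 - phi)^-1); last by ring.
  rewrite ler_wpM2l//.
  by apply: geometric_sum_le => //; exact: ltW.
rewrite SE mu_E.
have cv := @nondecreasing_cvg_mu _ _ _ (density_of mu (@measurable_cball R n.+1)
  (measurable_ball_weightE s (D := B)) (@weight_nonneg R n s)) Sk mSk.
have mU : measurable (\bigcup_k Sk k) by exact: bigcup_measurable.
have nd : nondecreasing_seq Sk.
  move=> i j ij; apply/subsetPset => z [Sz /= zi]; split=> //=.
  apply: le_trans zi; rewrite lef_pV2 ?posrE ?exprn_gt0//.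
  by rewrite ler_weXn2l// ler1n.
have {}cv := cv mU nd.
rewrite -(cvg_lim _ cv)//; apply: lime_le; first by apply/cvg_ex; eexists; exact: cv.
by apply: nearW => k; rewrite -mu_E; exact: Skle.
Qed.

End weak_type.

(** * Unboundedness on L^1 *)

Section test_boxes.
Variables (R : realType) (n : nat) (s t : R).
Local Notation CN := (n.+1.-tuple R[i]).
Local Notation B := (@cball R n.+1).
Local Notation mu := (ball_measure R n.+1).
Local Notation A := (n.+1%:R + 1 + (s + t)).

(** Continuity at 0, where the value is 1. It will make the real part of the kernel at least half of
    its modulus. *)
Lemma cos_atan_near0 (a : R) : exists2 k : R, 0 < k &
  forall u, `|u| <= k -> 2^-1 <= cos (a * atan u).
Proof.
pose h (u : R) := cos (a * atan u).
have ch : {for 0, continuous h}.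
  apply: (continuous_comp (f := fun u => a * atan u)); last exact: continuous_cos.
  by apply: cvgM; [exact: cvg_cst|exact: continuous_atan].
have h1 : 2^-1 < h 0 by rewrite /h atan0 mulr0 cos0 invf_lt1// ltr1n.
have /nbhs_ballP[e /= e0 He] : nbhs (0 : R) [set u | 2^-1 < h u].
  exact: (cvgr_gt _ ch _ h1).
exists (e / 2); first by rewrite divr_gt0.
move=> u ue; apply/ltW/He; rewrite /ball /= sub0r normrN.
by apply: le_lt_trans ue _; rewrite ltr_pdivrMr// ltr_pMr// ltr1n.
Qed.

(** With r = 2^(-k) this is D_k: sides of order r^2 in the first coordinate and r in the others, the
    shape of a quasi-ball of radius about r^2. *)
Definition test_box (c r : R) : set CN :=
  polybox (fun j => if j == ord0 then csquare_at (1 - r ^+ 2)%:C (c * r ^+ 2)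
                    else csquare_at 0 (c * r)).

Lemma measurable_test_box c r : measurable (test_box c r).
Proof.
by apply: measurable_polybox => j; case: ifP => _; exact: measurable_csquare_at.
Qed.

(** An area of order r^4 for the first coordinate and r^2 for each of the other [n] gives r^(2 (n +
    2)). *)
Lemma mu_test_box (c r : R) : 0 < c -> 0 < r ->
  mu (test_box c r) = (inv_vol R n.+1 * (2 * c) ^+ (2 * n.+1) * r ^+ (2 * n.+2))%:E.
Proof.
move=> c0 r0; rewrite ball_measureE (@lebesgue_polybox _ _ _
  (fun j => if j == ord0 then (2 * (c * r ^+ 2)) ^+ 2 else (2 * (c * r)) ^+ 2)).
- rewrite -EFinM; congr EFin; rewrite -mulrA; congr (_ * _).
  rewrite big_ord_recl /= prodr_const card_ord.
  rewrite (_ : (2 * (c * r)) ^+ 2 = (2 * c) ^+ 2 * r ^+ 2); last by ring.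
  rewrite [((2 * c) ^+ 2 * r ^+ 2) ^+ n]exprMn !exprM.
  rewrite [((2 * c) ^+ 2) ^+ n.+1]exprS [(r ^+ 2) ^+ n.+2]exprS [(r ^+ 2) ^+ n.+1]exprS.
  ring.
- by move=> j; case: ifP => _; exact: measurable_csquare_at.
- by move=> j; case: ifP => _; rewrite lebesgue_csquare_at// ?mulr_gt0// exprn_gt0.
Qed.

Variable c : R.
Hypotheses (c0 : 0 < c) (c8 : c <= (8 * n.+1%:R)^-1).

Let c18 : c <= 8^-1.
Proof.
apply: (le_trans c8); rewrite lef_pV2 ?posrE// ?mulr_gt0//.
by rewrite ler_peMr// ler1n.
Qed.

(** Each coordinate contributes at most 2 c^2 r^2, and [c8] bounds (n + 1) c by 1/8, which absorbs
    the dimension. *)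
Lemma test_box_tail (r : R) (z : CN) : test_box c r z ->
  \sum_(j < n.+1 | j != ord0) normc (tnth z j) ^+ 2 <= c * r ^+ 2.
Proof.
move=> Dz.
apply: (@le_trans _ _ (\sum_(j < n.+1) ((c * r) ^+ 2 + (c * r) ^+ 2))).
  rewrite [leRHS](bigD1 ord0)//= ler_wpDl ?addr_ge0 ?sqr_ge0//.
  apply: ler_sum => j j0; have := Dz j; rewrite (negPf j0) /csquare_at /= !subr0.
  move=> [h1 h2]; rewrite normc_sqr.
  have sq (x : R) : `|x| <= c * r -> x ^+ 2 <= (c * r) ^+ 2.
    move=> h; rewrite -(real_normK (num_real x)) ler_pXn2r ?nnegrE//.
    exact: le_trans h.
  by rewrite lerD// sq.
rewrite sumr_const card_ord -mulr_natl.
have nc : n.+1%:R * c <= 8^-1.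
  rewrite (le_trans (ler_wpM2l _ c8))// invfM mulrCA mulfV ?mulr1//.
rewrite (_ : _ * _ = 2 * (n.+1%:R * c) * (c * r ^+ 2)); last by ring.
rewrite ler_piMl//; first by rewrite mulr_ge0 ?sqr_ge0// ltW.
by move: (n.+1%:R * c) nc => u; lra.
Qed.

Lemma test_box_head (r : R) (z : CN) : test_box c r z ->
  `|complex.Re (tnth z ord0) - (1 - r ^+ 2)| <= c * r ^+ 2 /\
  `|complex.Im (tnth z ord0)| <= c * r ^+ 2.
Proof. by move=> /(_ ord0); rewrite eqxx /csquare_at /= subr0. Qed.

(** The main term 1 - x^2 lies between 1 - x and 2 (1 - x), where 1 - x is close to r^2; the rest is
    a small multiple of r^2. The condition [r <= 2^-1] keeps x in [0, 1]. *)
Lemma test_box_delta (r : R) (z : CN) : 0 < r <= 2^-1 -> test_box c r z ->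
  r ^+ 2 <= 4 * delta z /\ delta z <= 4 * r ^+ 2.
Proof.
move=> /andP[r0 r2] Dz; have [hx hy] := test_box_head Dz.
rewrite deltaE (bigD1 ord0)//=; have := test_box_tail Dz.
have : 0 <= \sum_(j < n.+1 | j != ord0) normc (tnth z j) ^+ 2.
  by rewrite sumr_ge0// => j _; rewrite sqr_ge0.
set S := \sum_(_ < _ | _) _; rewrite normc_sqr.
move: hx hy; set x := complex.Re _; set y := complex.Im _.
rewrite !ler_norml => /andP[x1 x2] /andP[y1 y2] S0 S1.
have q0 : 0 < r ^+ 2 by rewrite exprn_gt0.
have q4 : r ^+ 2 <= 4^-1.
  rewrite (_ : 4^-1 = 2^-1 ^+ 2 :> R); last by field.
  by rewrite ler_pXn2r ?nnegrE ?(ltW r0).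
move: (r ^+ 2) q0 q4 x1 x2 y1 y2 S1 => q q0 q4 x1 x2 y1 y2 S1.
have cq : c * q <= 8^-1 * q by rewrite ler_pM2r.
have cq0 : 0 <= c * q by rewrite mulr_ge0// ltW.
have yy : y ^+ 2 <= 8^-1 * q.
  apply: (@le_trans _ _ (`|y| * 1)); last first.
    by rewrite mulr1 ler_norml; apply/andP; split; lra.
  rewrite -(real_normK (num_real y)) expr2 ler_wpM2l// ler_norml.
  by apply/andP; split; lra.
have yy0 := sqr_ge0 y.
have xx : x ^+ 2 <= x by rewrite expr2; nra.
have xx2 : 2 * x - 1 <= x ^+ 2 by have := sqr_ge0 (x - 1); nra.
by split; lra.
Qed.

(** The box of [z] is the larger one, so the distance of z_1 from 1, about r^2, governs the real
    part, while the imaginary part consists of three perturbations of size c r^2. A small [c] thus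
    forces a small argument. *)
Lemma test_box_1Bcdot (r r' : R) (z w : CN) : 0 < r' <= r -> r <= 2^-1 ->
  test_box c r z -> test_box c r' w ->
  [/\ r ^+ 2 <= 2 * complex.Re (1 - cdot z w),
      complex.Re (1 - cdot z w) <= 3 * r ^+ 2 &
      `|complex.Im (1 - cdot z w)| <= 3 * c * r ^+ 2].
Proof.
move=> /andP[r0 rr] r2 Dz Dw.
have [hx hy] := test_box_head Dz; have [hx' hy'] := test_box_head Dw.
have T1 := test_box_tail Dz; have T2 := test_box_tail Dw.
have q0 : 0 < r ^+ 2 by rewrite exprn_gt0// (lt_le_trans r0).
have qq : r' ^+ 2 <= r ^+ 2 by rewrite ler_pXn2r ?nnegrE// ?ltW// (lt_le_trans r0).
have q'0 : 0 < r' ^+ 2 by rewrite exprn_gt0.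
have q4 : r ^+ 2 <= 4^-1.
  rewrite (_ : 4^-1 = 2^-1 ^+ 2 :> R); last by field.
  by rewrite ler_pXn2r ?nnegrE// ltW// (lt_le_trans r0).
rewrite /cdot (bigD1 ord0)//=.
set S := \sum_(_ < _ | _) _.
have nS : normc S <= c * r ^+ 2.
  apply: (le_trans (normc_sum_le _ _ _)).
  apply: (@le_trans _ _ (\sum_(j < n.+1 | j != ord0)
     (normc (tnth z j) ^+ 2 + normc (tnth w j) ^+ 2) / 2)).
    by apply: ler_sum => j _; exact: normcMJ_le.
  rewrite -mulr_suml big_split /= ler_pdivrMr//.
  have : c * r' ^+ 2 <= c * r ^+ 2 by rewrite ler_pM2l.
  by move: T1 T2; lra.
have SR := le_trans (normr_Re_le S) nS; have SI := le_trans (normr_Im_le S) nS.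
rewrite cReD cReN cReD cReM cReJ cImJ cImD cImN cImD cImM cReJ cImJ /=.
move: hx hy hx' hy' SR SI.
set x := complex.Re (tnth z ord0); set y := complex.Im (tnth z ord0).
set x' := complex.Re (tnth w ord0); set y' := complex.Im (tnth w ord0).
set SRe := complex.Re S; set SIm := complex.Im S.
move: (r ^+ 2) (r' ^+ 2) q0 qq q'0 q4 => q q' q0 qq q'0 q4.
have cq : c * q <= 8^-1 * q by rewrite ler_pM2r.
have cq' : c * q' <= c * q by rewrite ler_pM2l.
have cq0 : 0 < c * q' by rewrite mulr_gt0.
rewrite !ler_norml => /andP[x1 x2] /andP[y1 y2] /andP[x'1 x'2] /andP[y'1 y'2].
move=> /andP[SR1 SR2] /andP[SI1 SI2].
have cq'8 : c * q' <= 8^-1 * q' by rewrite ler_pM2r.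
have x'0 : 0 <= x' by lra.
have x'le1 : x' <= 1 by lra.
have x0 : 0 <= x by lra.
have xle1 : x <= 1 by lra.
have xx1 : x * x' <= x by rewrite ler_piMr.
have xx2 : x + x' - 1 <= x * x' by nra.
have ny : `|y| <= c * q by rewrite ler_norml y1.
have ny' : `|y'| <= c * q by rewrite ler_norml; apply/andP; split; lra.
have nyy : `|y * y'| <= c * q.
  rewrite normrM; apply: le_trans ny; rewrite ler_piMr//.
  by apply: le_trans ny' _; lra.
have nyx : `|y * x'| <= c * q.
  rewrite normrM (ger0_norm x'0); apply: le_trans ny; by rewrite ler_piMr.
have nxy : `|x * y'| <= c * q.
  rewrite normrM (ger0_norm x0); apply: le_trans ny'; by rewrite ler_piMl.
move: nyy nyx nxy; rewrite !ler_norml => /andP[? ?] /andP[? ?] /andP[? ?].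
by split; [lra|lra|apply/andP; split; lra].
Qed.

(** In a box the real part of 1 - z_1 equals r^2 up to a relative error 1/8, and the two values of
    r^2 differ by a factor of at least 4. *)
Lemma test_box_disjoint (r r' : R) : 0 < r' -> 2 * r' <= r ->
  test_box c r `&` test_box c r' = set0.
Proof.
move=> r0 rr; apply/seteqP; split=> // z [Dz Dz'].
have [+ _] := test_box_head Dz; have [+ _] := test_box_head Dz'.
rewrite !ler_norml => /andP[h1 _] /andP[_ h2].
have q0 : 0 < r' ^+ 2 by rewrite exprn_gt0.
have qq : 4 * r' ^+ 2 <= r ^+ 2 by rewrite expr2; nra.
have : c * r' ^+ 2 <= 8^-1 * r' ^+ 2 by rewrite ler_pM2r.
have : c * r ^+ 2 <= 8^-1 * r ^+ 2 by rewrite ler_pM2r//; lra.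
by move: h1 h2 => /=; lra.
Qed.

Lemma test_box_sub_ball (r : R) : 0 < r <= 2^-1 -> test_box c r `<=` B.
Proof.
move=> r2 z /(test_box_delta r2)[h _]; apply/delta_gt0.
have : 0 < r ^+ 2 by case/andP: r2 => r0 _; rewrite exprn_gt0.
by lra.
Qed.

End test_boxes.

(** * Lower bounds on the boxes and divergence *)

Section unbounded.
Variables (R : realType) (n : nat) (s t : R).
Hypothesis st1 : -1 < s + t.
Local Notation CN := (n.+1.-tuple R[i]).
Local Notation B := (@cball R n.+1).
Local Notation mu := (ball_measure R n.+1).
Local Notation A := (n.+1%:R + 1 + (s + t)).

Let A0 : 0 < A.
Proof. by rewrite -addrA addr_gt0// -ltrBlDl sub0r. Qed.

Section one_box.
Variables (c k : R).
Hypotheses (c0 : 0 < c) (c8 : c <= (8 * n.+1%:R)^-1) (ck : 6 * c <= k).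
Hypothesis cosk : forall u, `|u| <= k -> 2^-1 <= cos (A * atan u).
Local Notation D := (@test_box R n c).

Let c3 : 3 * c <= 1.
Proof.
apply: (@le_trans _ _ (3 * 8^-1)); last by rewrite ler_pdivrMr// mul1r ler_nat.
rewrite ler_pM2l//; apply: (le_trans c8); rewrite lef_pV2 ?posrE// ?mulr_gt0//.
by rewrite ler_peMr// ler1n.
Qed.

Lemma test_box_rho r r' (z w : CN) : 0 < r' <= r -> r <= 2^-1 -> D r z -> D r' w ->
  r ^+ 2 <= 4 * rho z w /\ rho z w <= 4 * r ^+ 2.
Proof.
move=> r'r r2 Dz Dw; have [h1 h2 h3] := test_box_1Bcdot c0 c8 r'r r2 Dz Dw.
have q0 : 0 < r ^+ 2 by rewrite exprn_gt0//; case/andP: r'r; exact: lt_le_trans.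
have h4 := Re_rho_le z w; have := normc_le_ReIm (1 - cdot z w).
rewrite -/(rho z w).
have re0 : 0 < complex.Re (1 - cdot z w) by lra.
rewrite (gtr0_norm re0).
have : 3 * c * r ^+ 2 <= 1 * r ^+ 2 by rewrite ler_pM2r.
by lra.
Qed.

Lemma test_box_cos r r' (z w : CN) : 0 < r' <= r -> r <= 2^-1 -> D r z -> D r' w ->
  2^-1 <= cos (- A * kernel_arg z w).
Proof.
move=> r'r r2 Dz Dw; have [h1 h2 h3] := test_box_1Bcdot c0 c8 r'r r2 Dz Dw.
have q0 : 0 < r ^+ 2 by rewrite exprn_gt0//; case/andP: r'r; exact: lt_le_trans.
have re0 : 0 < complex.Re (1 - cdot z w) by lra.
rewrite mulNr cosN /kernel_arg powR_inv1 ?(ltW re0)//.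
apply: cosk; apply: le_trans ck; rewrite normrM normfV (gtr0_norm re0).
rewrite ler_pdivrMr//; apply: (le_trans h3).
(* The tangent of the argument is at most 3 c r^2 / (r^2 / 2) = 6 c, which is the origin of [ck]. *)
rewrite (_ : 6 * c * _ = 3 * c * (2 * complex.Re (1 - cdot z w))); last by ring.
by rewrite ler_pM2l// mulr_gt0.
Qed.

Variable r' : R.
Hypotheses (r'0 : 0 < r') (r'2 : r' <= 2^-1).

Let f (w : CN) : R[i] := (\1_(D r') w)%:C.

Let mD r : measurable (D r). Proof. exact: measurable_test_box. Qed.

Lemma measurable_test_fun : measurable_fun B f.
Proof.
have := measurableT_comp (@measurable_prod_to_complex R)
  (measurable_fun_pair (measurable_indic (mD r')) (@measurable_cst _ _ CN _ setT (0 : R))).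
exact: measurable_funTS.
Qed.

Lemma normc_test_fun w : normc (f w) = \1_(D r') w.
Proof. by rewrite normc_real indicE; case: (_ \in _); rewrite /= ?normr1 ?normr0. Qed.

Let r'B : D r' `<=` B.
Proof. by apply: (test_box_sub_ball c0 c8); rewrite r'0. Qed.

Lemma L1norm_test_funE :
  L1norm s f = (\int[mu]_w (\1_(D r') w * ball_weight s w)%:E)%E.
Proof.
rewrite /L1norm integral_mkcond; apply: eq_integral => w _.
rewrite patchE; case: ifPn => [_|/negP Bw]; first by rewrite normc_test_fun.
rewrite indicE memNset ?mul0r// => Dw; apply: Bw; apply/mem_set; exact: r'B.
Qed.

Let mI (q : R) : measurable_fun setT (fun w => (q * (\1_(D r') w * ball_weight s w))%:E).
Proof.
apply/measurable_EFinP; apply: measurable_funM => //; apply: measurable_funM => //.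
exact: measurable_ball_weight.
Qed.

Let mI1 : measurable_fun setT (fun w => (\1_(D r') w * ball_weight s w)%:E).
Proof. by have := mI 1; under eq_fun do rewrite mul1r. Qed.

Let I0 w : 0 <= \1_(D r') w * ball_weight s w.
Proof. by rewrite mulr_ge0 ?ball_weight_ge0. Qed.

Lemma test_box_weight (a r : R) (z : CN) : 0 < r <= 2^-1 -> D r z ->
  (r ^+ 2) `^ a <= 4 `^ `|a| * delta z `^ a /\
  delta z `^ a <= 4 `^ `|a| * (r ^+ 2) `^ a.
Proof.
move=> r2 Dz; have [h1 h2] := test_box_delta c0 c8 r2 Dz.
have q0 : 0 < r ^+ 2 by rewrite exprn_gt0//; case/andP: r2.
have d0 : 0 < delta z by lra.
by split; apply: powR_le_comparable => //; rewrite ler1n.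
Qed.

Lemma L1norm_test_fun : (0 < L1norm s f < +oo)%E.
Proof.
have r2 : 0 < r' <= 2^-1 by rewrite r'0.
have muD := mu_test_box n c0 r'0.
have v0 := inv_vol_gt0 R n.+1.
set v := inv_vol R n.+1 * _ * _ in muD.
have vpos : 0 < v by rewrite mulr_gt0 ?exprn_gt0// mulr_gt0 ?exprn_gt0// mulr_gt0.
have q0 : 0 < r' ^+ 2 by rewrite exprn_gt0.
have intD (q : R) : 0 <= q -> (\int[mu]_w (q * \1_(D r') w)%:E)%E = (q * v)%:E.
  move=> q00; under eq_integral do rewrite EFinM.
  rewrite ge0_integralZl ?lee_fin//; last exact/measurable_EFinP.
  by rewrite integral_indic// setIT muD.
have mq (q : R) : measurable_fun setT (fun w => (q * \1_(D r') w)%:E).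
  by apply/measurable_EFinP; apply: measurable_funM.
rewrite L1norm_test_funE; apply/andP; split.
  apply: (@lt_le_trans _ _ (\int[mu]_w ((r' ^+ 2) `^ s / 4 `^ `|s| * \1_(D r') w)%:E)%E).
    rewrite intD ?divr_ge0 ?powR_ge0// lte_fin.
    by rewrite mulr_gt0// divr_gt0 ?powR_gt0.
  apply: ge0_le_integral => //.
    by move=> w _; rewrite lee_fin mulr_ge0 ?divr_ge0 ?powR_ge0.
  move=> w _; rewrite lee_fin indicE; have [/set_mem Dw|_] := boolP (w \in D r').
    rewrite mulr1 mul1r ler_pdivrMr ?powR_gt0// mulrC.
    by have [] := test_box_weight s r2 Dw.
  by rewrite mulr0 mul0r.
apply: (@le_lt_trans _ _ (\int[mu]_w (4 `^ `|s| * (r' ^+ 2) `^ s * \1_(D r') w)%:E)%E).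
  apply: ge0_le_integral => //.
    by move=> w _; rewrite lee_fin.
  move=> w _; rewrite lee_fin indicE; have [/set_mem Dw|_] := boolP (w \in D r').
    by rewrite mulr1 mul1r; have [] := test_box_weight s r2 Dw.
  by rewrite mulr0 mul0r.
by rewrite intD ?ltry// mulr_ge0 ?powR_ge0.
Qed.

Lemma test_fun_integrandE z w : integrand_Re s t f z w =
  rho z w `^ (- A) * cos (- A * kernel_arg z w) * (\1_(D r') w * ball_weight s w).
Proof.
rewrite /integrand_Re !patchE.
have [/set_mem Bw|/negP Bw] := boolP (w \in B).
  by rewrite /f /= mulr0 subr0 !mulrA.
rewrite !mulr0 subr0 mulr0 mul0r indicE memNset ?mul0r ?mulr0// => Dw.
by apply: Bw; apply/mem_set; exact: r'B.
Qed.

(** On the pair of boxes Re K >= |K| / 2 and |K| >= 4^(-A) (r^2)^(-A), so no cancellation occurs and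
    integrating the real part loses only constants. *)
Lemma bergman_op_test_fun_ge r z : r' <= r <= 2^-1 -> D r z ->
  (r ^+ 2) `^ (- A) / (2 * 4 `^ A) * delta z `^ t * fine (L1norm s f) <=
  normc (bergman_op s t f z).
Proof.
move=> /andP[rr r2] Dz.
have r0 : 0 < r by exact: lt_le_trans rr.
have r'r : 0 < r' <= r by rewrite r'0.
have q0 : 0 < r ^+ 2 by rewrite exprn_gt0.
have Bz : B z by apply: (test_box_sub_ball c0 c8 _ Dz); rewrite r0.
apply: le_trans (le_trans (ler_norm _) (normr_Re_le _)).
rewrite (bergman_opE _ _ _ Bz) /= ball_weightE.
rewrite mulrAC mulrC ler_pM2l ?powR_gt0//; last exact/delta_gt0.
have /andP[M0 Moo] := L1norm_test_fun.
have Mfin : L1norm s f \is a fin_num by rewrite ge0_fin_numE// ltW.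
set q := _ / _.
have qle w : q * (\1_(D r') w * ball_weight s w) <= integrand_Re s t f z w.
  rewrite test_fun_integrandE [X in _ * (X * _)]indicE.
  rewrite [X in _ <= _ * (X * _)]indicE.
  have [/set_mem Dw|_] := boolP (w \in D r'); last by rewrite !mul0r !mulr0.
  rewrite ler_wpM2r ?mul1r ?ball_weight_ge0//.
  have [h1 h2] := test_box_rho r'r r2 Dz Dw.
  have rho0 : 0 < rho z w by lra.
  have := @powR_le_comparable _ 4 (rho z w) (r ^+ 2) (- A).
  rewrite normrN (gtr0_norm A0) => /(_ _ rho0 q0 h2 h1) h3.
  have cs := test_box_cos r'r r2 Dz Dw.
  rewrite /q invfM mulrA (mulrAC _ 2^-1) ler_pM ?invr_ge0 ?divr_ge0 ?powR_ge0//.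
  by rewrite ler_pdivrMr ?powR_gt0// mulrC h3// ler1n.
(* The upper bound serves finiteness alone: an infinite integral would make [Rintegral] equal to
   0. *)
have leq w : integrand_Re s t f z w <=
    4 `^ A * (r ^+ 2) `^ (- A) * (\1_(D r') w * ball_weight s w).
  rewrite test_fun_integrandE [X in _ * (X * _) <= _]indicE.
  rewrite [X in _ <= _ * (X * _)]indicE.
  have [/set_mem Dw|_] := boolP (w \in D r'); last by rewrite !mul0r !mulr0.
  rewrite ler_wpM2r ?mul1r ?ball_weight_ge0//.
  have [h1 h2] := test_box_rho r'r r2 Dz Dw.
  have rho0 : 0 < rho z w by lra.
  have := @powR_le_comparable _ 4 (r ^+ 2) (rho z w) (- A).
  rewrite normrN (gtr0_norm A0) => /(_ _ q0 rho0 h1 h2) h3.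
  apply: (@le_trans _ _ (rho z w `^ (- A))); last by rewrite h3// ler1n.
  by rewrite ler_piMr ?powR_ge0// cos_le1.
have mRe : measurable_fun setT (fun w => (integrand_Re s t f z w)%:E).
  apply/measurable_EFinP.
  exact: (measurable_fun_pair2 z (measurable_integrand_Re s t measurable_test_fun)).
have q00 : 0 <= q by rewrite divr_ge0 ?mulr_ge0 ?powR_ge0.
have Re0 w : 0 <= integrand_Re s t f z w.
  by apply: le_trans (qle w); rewrite mulr_ge0.
have scale (x : R) : 0 <= x ->
    (\int[mu]_w (x * (\1_(D r') w * ball_weight s w))%:E = x%:E * L1norm s f)%E.
  move=> x0; under eq_integral do rewrite EFinM.
  rewrite ge0_integralZl ?lee_fin ?L1norm_test_funE//.
  by move=> w _; rewrite lee_fin.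
have lower : (q%:E * L1norm s f <= \int[mu]_w (integrand_Re s t f z w)%:E)%E.
  rewrite -scale//; apply: ge0_le_integral => //.
  - by move=> w _; rewrite lee_fin mulr_ge0.
  - by move=> w _; rewrite lee_fin.
have upper : (\int[mu]_w (integrand_Re s t f z w)%:E < +oo)%E.
  apply: (@le_lt_trans _ _ ((4 `^ A * (r ^+ 2) `^ (- A))%:E * L1norm s f)%E).
    rewrite -scale ?mulr_ge0 ?powR_ge0//; apply: ge0_le_integral => //.
    - by move=> w _; rewrite lee_fin.
    - by move=> w _; rewrite lee_fin.
  by rewrite -(fineK Mfin) -EFinM ltry.
rewrite /Rintegral -lee_fin EFinM fineK// fineK//.
rewrite ge0_fin_numE//; apply: integral_ge0 => w _.
by rewrite lee_fin.
Qed.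

(** Kernel (r^2)^(-A), weight (r^2)^(s + t) and volume r^(2 (n + 2)) multiply to 1, as A = n + 2 + s
    + t; the bound is therefore the same at every scale. In the weight, t comes from the operator
    and s from the norm. *)
Lemma mass_bergman_op_test_box r : r' <= r <= 2^-1 ->
  (((2 * 4 `^ A * 4 `^ `|s + t|)^-1 * (inv_vol R n.+1 * (2 * c) ^+ (2 * n.+1)) *
     fine (L1norm s f))%:E <=
   mass s (measurable_bergman_op s t measurable_test_fun) (D r))%E.
Proof.
move=> rr; have /andP[r'r r2] := rr.
have r0 : 0 < r by exact: lt_le_trans r'r.
have r02 : 0 < r <= 2^-1 by rewrite r0.
have q0 : 0 < r ^+ 2 by rewrite exprn_gt0.
have /andP[M0 Moo] := L1norm_test_fun.
have M'0 : 0 <= fine (L1norm s f) by rewrite fine_ge0// ltW.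
have DB : D r `&` B = D r by apply: setIidl; exact: (test_box_sub_ball c0 c8).
set M := fine _ in M'0 *; set v := inv_vol _ _ * _.
pose q := (r ^+ 2) `^ (- A) / (2 * 4 `^ A) * M * ((r ^+ 2) `^ (s + t) / 4 `^ `|s + t|).
have q00 : 0 <= q by rewrite !mulr_ge0 ?invr_ge0 ?mulr_ge0 ?powR_ge0.
apply: (@le_trans _ _ (\int[mu]_(w in D r) (cst q%:E) w)%E).
  rewrite integral_cst// mu_test_box// -/v -EFinM lee_fin le_eqVlt; apply/orP; left; apply/eqP.
  have E : (r ^+ 2) `^ (- A) * (r ^+ 2) `^ (s + t) * r ^+ (2 * n.+2) = 1.
    have rD x y : (r ^+ 2) `^ x * (r ^+ 2) `^ y = (r ^+ 2) `^ (x + y).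
      by rewrite powRD// (gt_eqF q0) implybT.
    rewrite exprM -(powR_mulrn n.+2 (ltW q0)) !rD.
    rewrite (_ : - A + (s + t) + n.+2%:R = 0) ?powRr0//.
    by rewrite -[n.+2%:R]natr1; ring.
  rewrite /q [RHS](_ : _ = (2 * 4 `^ A * 4 `^ `|s + t|)^-1 * v * M *
    ((r ^+ 2) `^ (- A) * (r ^+ 2) `^ (s + t) * r ^+ (2 * n.+2))).
    by rewrite E mulr1.
  by rewrite invfM; field; rewrite !gt_eqF ?powR_gt0.
rewrite -[leRHS]/(\int[mu]_(w in D r `&` B) _)%E DB.
have mT := measurable_bergman_op s t measurable_test_fun.
apply: ge0_le_integral => //.
- apply/measurable_EFinP; apply: measurable_funM.
    apply: (@measurable_funS _ _ _ _ B) => //; first exact: measurable_cball.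
      by rewrite -DB; exact: subIsetr.
    by apply: measurable_normc;
      [exact: (measurableT_comp (@measurable_Re R) mT)
      |exact: (measurableT_comp (@measurable_Im R) mT)].
  by apply: measurable_funTS; exact: measurable_ball_weight.
move=> z Dz; rewrite lee_fin /q.
have Bz : B z by rewrite -DB in Dz; case: Dz.
have dz : 0 < delta z by exact/delta_gt0.
apply: le_trans (ler_wpM2r (ball_weight_ge0 s z) (bergman_op_test_fun_ge rr Dz)).
rewrite ball_weightE -/M.
rewrite [leRHS](_ : _ = (r ^+ 2) `^ (- A) / (2 * 4 `^ A) * M * (delta z `^ t * delta z `^ s));
  last by ring.
rewrite -powRD ?(gt_eqF dz) ?implybT// (addrC t).
rewrite ler_wpM2l ?mulr_ge0 ?invr_ge0 ?mulr_ge0 ?powR_ge0//.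
rewrite ler_pdivrMr ?powR_gt0// mulrC.
by have [] := test_box_weight (s + t) r02 Dz.
Qed.

End one_box.

Lemma not_bounded : ~ @bounded_L1_L1 R n.+1 s (@bergman_op R n.+1 s t).
Proof.
move=> [C C0 HC].
have [k k0 cosk] := cos_atan_near0 A.
pose c := Num.min (8 * n.+1%:R)^-1 (k / 6).
have c0 : 0 < c by rewrite /c lt_min invr_gt0 mulr_gt0// divr_gt0.
have c8 : c <= (8 * n.+1%:R)^-1 by rewrite /c ge_min lexx.
have ck : 6 * c <= k by rewrite mulrC -ler_pdivlMr// /c ge_min lexx orbT.
pose b := (2 * 4 `^ A * 4 `^ `|s + t|)^-1 * (inv_vol R n.+1 * (2 * c) ^+ (2 * n.+1)).
have b0 : 0 < b.
  rewrite mulr_gt0 ?invr_gt0 ?mulr_gt0 ?powR_gt0 ?exprn_gt0 ?mulr_gt0//.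
  exact: inv_vol_gt0.
(* Enough scales for the [m] disjoint boxes, each contributing [b] times the norm of f, to exceed
   [C] times that norm. *)
pose m := (Num.bound (C / b)).+1.
have mC : C < b * m%:R.
  rewrite mulrC -ltr_pdivrMr// /m (lt_le_trans (archi_boundP _))//.
    by rewrite divr_ge0// ltW.
  by rewrite ler_nat.
pose r (i : nat) : R := 2^-1 ^+ i.
have r0 i : 0 < r i by rewrite exprn_gt0.
have rle i j : (i <= j)%N -> r j <= r i.
  by move=> ij; rewrite ler_wiXn2l// invf_le1// ler1n.
have r2 i : (0 < i)%N -> r i <= 2^-1 by move=> /rle; rewrite {2}/r expr1.
pose f (w : n.+1.-tuple R[i]) : R[i] := (\1_(test_box c (r m)) w)%:C.
have mf : measurable_fun B f by exact: measurable_test_fun.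
have /andP[M0 Moo] := L1norm_test_fun c0 c8 (r0 m) (r2 m isT).
have [_] := HC f (conj mf Moo).
apply/negP; rewrite -ltNge.
rewrite -(massB s (measurable_bergman_op s t mf)).
set F := mass _ _.
apply: (@lt_le_trans _ _ (\sum_(i <- iota 1 m) F (test_box c (r i)))%E); last first.
  apply: measure_sum_disjoint_le.
  - exact: measurable_cball.
  - by move=> i; exact: measurable_test_box.
  - move=> i; rewrite mem_iota => /andP[i0 _].
    by apply: (test_box_sub_ball c0 c8); rewrite r0 r2.
  - elim: m 1%N {mC f mf M0 Moo F} => //= m IH a; split; last exact: IH.
    move=> j; rewrite mem_iota => /andP[aj _].
    apply: (test_box_disjoint c8) => //.
    by rewrite -ler_pdivlMl// mulrC -exprSr; exact: rle.
have Mfin : L1norm s f \is a fin_num by rewrite ge0_fin_numE// ltW.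
apply: (@lt_le_trans _ _ (\sum_(i <- iota 1 m) (b * fine (L1norm s f))%:E)%E).
  rewrite sumEFin big_const_seq count_predT size_iota iter_addr_0.
  rewrite -mulr_natr mulrAC -(fineK Mfin) -EFinM lte_fin ltr_pM2r//.
  by rewrite fine_gt0// M0.
rewrite big_seq [leRHS]big_seq; apply: lee_sum => i; rewrite mem_iota => /andP[i0 im].
apply: (mass_bergman_op_test_box c0 c8 ck cosk) => //.
  exact: r2.
by rewrite r2// rle.
Qed.

End unbounded.

Theorem theorem1p2 (R : realType) (N : nat) (q s t : R) (hN : (1 <= N)%N)
  (hqs : q = s) (hs : -1 < s) (hst : -1 < s + t) (hs2t : -1 < s + 2 * t) :
  @bounded_L1_weakL1 R N q (@bergman_op R N s t) /\
  ~ @bounded_L1_L1 R N q (@bergman_op R N s t).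
Proof.
rewrite {}hqs; case: N hN => [//|n] _.
by split; [exact: weak_type|exact: not_bounded].
Qed.
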